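(* Let $G\le\mathrm{O}(d)$ be a semialgebraic subgroup. If the orbits of $G$ are the concentric spheres $\{x:\|x\|=r\}$, $r\ge0$, then the max filtering map of $G$ is $d$-strongly separating. Otherwise, the max filtering map of $G$ is $1$-strongly separating but not $2$-strongly separating.
   Context: A basic semialgebraic subset of $\mathbb{R}^N$ is a set $\{x:p(x)\ge0\}$ with $p$ a real polynomial; a semialgebraic set is one obtained from basic semialgebraic sets by finitely many unions, intersections and complements. A subgroup of $\mathrm{O}(d)$ is semialgebraic if it is a semialgebraic subset of $\mathbb{R}^{d\times d}$. Every semialgebraic set is a finite disjoint union of semialgebraic sets each homeomorphic to an open hypercube $(0,1)^k$ (with $k\ge0$, $k=0$ meaning a point); its dimension is the maximum such $k$ (independent of the decomposition). For $x\in\mathbb{R}^d$, $[x]:=\{gx:g\in G\}$, and the max filtering map is $\mathbb{R}^d\times\mathbb{R}^d\to\mathbb{R}$, $(x,y)\mapsto\langle\!\langle[x],[y]\rangle\!\rangle:=\sup_{p\in[x],q\in[y]}\langle p,q\rangle$. For $k\in\mathbb{N}$, the max filtering map is $k$-strongly separating if for all $x,y\in\mathbb{R}^d$ with $[x]\ne[y]$, the set $\{z\in\mathbb{R}^d:\langle\!\langle[z],[x]\rangle\!\rangle=\langle\!\langle[z],[y]\rangle\!\rangle\}$ has dimension at most $d-k$. *)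

(* Defs.v *)
From HB Require Import structures.
From mathcomp Require Import all_boot all_order all_algebra.
From mathcomp Require Import all_classical all_reals.
Set Implicit Arguments. Unset Strict Implicit. Unset Printing Implicit Defensive.
Import Order.TTheory GRing.Theory Num.Theory.
Local Open Scope classical_set_scope.
Local Open Scope ring_scope.

Section SemiAlg.
Variable R : realType.

(* Points of R^N are represented by real m x n matrices (N = m*n):
   column vectors 'cV_d for R^d and square matrices 'M_d for R^(d x d). *)

Inductive pexpr (m n : nat) : Type :=
| PConst of R
| PVar of 'I_m & 'I_n
| PAdd of pexpr m n & pexpr m n
| PMul of pexpr m n & pexpr m n.

Fixpoint peval m n (p : pexpr m n) (A : 'M[R]_(m, n)) : R :=
  match p with
  | PConst c => c
  | PVar i j => A i j
  | PAdd p q => peval p A + peval q A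
  | PMul p q => peval p A * peval q A
  end.

Inductive semialg m n : set 'M[R]_(m, n) -> Prop :=
| sa_basic (p : pexpr m n) : semialg [set A | 0 <= peval p A]
| sa_union S T : semialg S -> semialg T -> semialg (S `|` T)
| sa_inter S T : semialg S -> semialg T -> semialg (S `&` T)
| sa_compl S : semialg S -> semialg (~` S).

Definition mdist2 m n (A B : 'M[R]_(m, n)) : R :=
  \sum_(i < m) \sum_(j < n) (A i j - B i j) ^+ 2.

Definition cont_on m n p q (S : set 'M[R]_(m, n)) (f : 'M[R]_(m, n) -> 'M[R]_(p, q)) :=
  forall a, S a -> forall e, 0 < e -> exists2 del, 0 < del &
    forall b, S b -> mdist2 a b < del -> mdist2 (f a) (f b) < e.

(** Open hypercube (0,1)^k (a point when k = 0). *)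
Definition cube (k : nat) : set 'rV[R]_k := [set y | forall i, 0 < y 0 i < 1].
Arguments cube k _ : clear implicits.

Definition homeo_cube m n (S : set 'M[R]_(m, n)) (k : nat) :=
  exists (f : 'M[R]_(m, n) -> 'rV[R]_k) (g : 'rV[R]_k -> 'M[R]_(m, n)),
    [/\ (forall a, S a -> cube k (f a)),
        (forall y, cube k y -> S (g y)),
        (forall a, S a -> g (f a) = a),
        (forall y, cube k y -> f (g y) = y) &
        cont_on S f /\ cont_on (cube k) g].

(** "S has dimension at most r" (r an integer; r < 0 forces S empty):
    S is a finite disjoint union of semialgebraic sets, each homeomorphic
    to an open hypercube (0,1)^k with k <= r. *)
Definition dim_le m n (S : set 'M[R]_(m, n)) (r : int) :=
  exists (c : nat) (C : 'I_c -> set 'M[R]_(m, n)) (K : 'I_c -> nat),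
    [/\ (forall i, semialg (C i)),
        (forall i, homeo_cube (C i) (K i)),
        (forall i, (K i)%:Z <= r),
        (forall i j, i != j -> C i `&` C j = set0) &
        S = [set x | exists i, C i x]].

Definition orthogonal d (g : 'M[R]_d) := g^T *m g = 1%:M.

Definition subgroup_Od d (G : set 'M[R]_d) :=
  [/\ (forall g, G g -> orthogonal g),
      G 1%:M,
      (forall g h, G g -> G h -> G (g *m h)) &
      (forall g, G g -> G g^T)].  (* g^T = g^-1 for orthogonal g *)

Definition ip d (x y : 'cV[R]_d) : R := \sum_(i < d) x i 0 * y i 0.

Definition orbit d (G : set 'M[R]_d) (x : 'cV[R]_d) : set 'cV[R]_d :=
  [set g *m x | g in G].

Definition maxfilt d (G : set 'M[R]_d) (x y : 'cV[R]_d) : R :=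
  sup [set r | exists p q, [/\ orbit G x p, orbit G y q & r = ip p q]].

Definition strongly_separating d (G : set 'M[R]_d) (k : nat) :=
  forall x y : 'cV[R]_d, orbit G x <> orbit G y ->
    dim_le [set z | maxfilt G z x = maxfilt G z y] (d%:Z - k%:Z).

Definition orbits_are_spheres d (G : set 'M[R]_d) :=
  forall x : 'cV[R]_d, orbit G x = [set y | ip y y = ip x x].

End SemiAlg.

(* Main.v *)
Require Import Defs.
From HB Require Import structures.
From mathcomp Require Import all_boot all_order all_algebra.
From mathcomp Require Import all_classical all_reals.
From mathcomp Require Import ring lra zify topology normedtype polyrcf polyorder.
From mathcomp Require ordered_qelim qe_rcf.
From Stdlib Require List.

(* A semialgebraic subgroup G of O(d) is closed: like every set in the Boolean
   algebra generated by closed sets, G is relatively open in its closure near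
   some point, and G acts transitively on itself.  Hence <<[z],[x]>> is attained.

   Write Z = {z : <<[z],[x]>> = <<[z],[y]>>}, a semialgebraic set by quantifier
   elimination.  If Z contains a neighbourhood of z and |x| <= |y|, moving z in
   the direction of a maximizer q in [y] forces q into [x]; so Z has empty
   interior when [x] <> [y], and a cell decomposition gives dim Z <= d-1.

   If the orbits are not the spheres, take x, y of equal norm in distinct orbits.
   Then <<[z],[x]>> - <<[z],[y]>> changes sign between z = x and z = y, so Z meets
   all lines parallel to y - x close to the line (xy).  Decomposing cylindrically
   in that direction, some semialgebraic piece of Z contains the graph of a
   continuous function over a (d-1)-dimensional cell.  If all pieces were
   homeomorphic to cubes of dimension <= d-2, this would embed (0,1)^(d-1) in
   (0,1)^k with k <= d-2.

   Such an embedding phi is impossible: the coordinates of phi^-1 are uniformly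
   close to functions that are Lipschitz in phi, so by Poincare-Miranda the values
   of these functions come close to every point of a (d-1)-dimensional box, which
   contradicts a count of small boxes in (0,1)^k. *)

(** The condition [dim_le] asks for some decomposition into pieces whose homeomorphisms with cubes
    are merely continuous. An upper bound thus needs one good decomposition, while its negation must
    refute all of them; this is why topological invariance of dimension enters beside semialgebraic
    geometry. That Z is nonempty would not suffice: the strict signs at x and at y survive on nearby
    parallel lines, which supplies the d-1 parameters of the embedded cell.

    The inverse of an embedding comes without a modulus of continuity that a count of boxes could
    use. A Lipschitz approximation fixes its constant before the boxes are made small.
    Poincare-Miranda is needed only on finite grids, where it is a parity statement: the cup product
    modulo 2 of the coboundaries of n labels sums to 1 over the grid.

    Continuity of roots is obtained without complex roots or multiplicities: the families of
    polynomials are closed under derivation, so that each root is simple for some member and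
    persists through a sign change. *)

Set Implicit Arguments. Unset Strict Implicit. Unset Printing Implicit Defensive.

(** * A cubical Poincare-Miranda theorem on grids *)

Section GridCochains.
Implicit Types (v w : nat -> nat) (I : seq nat).

Definition upd v i t : nat -> nat := fun k => if k == i then t else v k.
Definition inc v j := upd v j (v j).+1.
Definition rm (j : nat) I := [seq k <- I | k != j].

(* A cochain modulo 2 takes a cube, given by its lowest vertex v and the list I of its
   edge directions, to a Boolean. *)
Definition cobound (b : (nat -> nat) -> seq nat -> bool) v I : bool :=
  \big[addb/false]_(j <- I) (b (inc v j) (rm j I) (+) b v (rm j I)).

(* The cup product of the coboundaries of the 0-cochains in L. *)
Fixpoint cup (L : seq ((nat -> nat) -> bool)) v I : bool :=
  if L is s :: L' then
    \big[addb/false]_(j <- I) ((s (inc v j) (+) s v) && cup L' (inc v j) (rm j I))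
  else nilp I.

Lemma upd_comm v i j t u : i != j -> upd (upd v i t) j u = upd (upd v j u) i t.
Proof.
move=> ij; apply/funext => k; rewrite /upd.
by case: (eqVneq k j) => [->|//]; rewrite eq_sym (negPf ij).
Qed.

Lemma inc_comm v i j : i != j -> inc (inc v i) j = inc (inc v j) i.
Proof.
move=> ij; rewrite /inc [X in upd _ j X.+1]/upd eq_sym (negPf ij) upd_comm //.
by rewrite [X in _ = upd _ i X.+1]/upd (negPf ij).
Qed.

Lemma rm_comm i j I : rm i (rm j I) = rm j (rm i I).
Proof. by rewrite /rm -!filter_predI; apply: eq_filter => k /=; rewrite andbC. Qed.

Lemma sym_sum2 (A : nat -> nat -> bool) I : (forall j k, A j k = A k j) ->
  (forall j, A j j = false) ->
  \big[addb/false]_(j <- I) \big[addb/false]_(k <- I) A j k = false.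
Proof.
move=> symA A0; elim: I => [|a I IH]; first by rewrite big_nil.
rewrite !big_cons A0 /=; under [X in _ (+) X]eq_bigr do rewrite big_cons.
rewrite big_split /= IH addbF.
by under [X in _ (+) X]eq_bigr do rewrite symA; rewrite addbb.
Qed.

(** The double sum runs over ordered pairs of distinct directions and its summand is symmetric, so
    the terms cancel modulo 2. *)
Lemma cobound_cobound b v I : cobound (cobound b) v I = false.
Proof.
rewrite /cobound.
pose A j k := (k != j) && (b (inc (inc v j) k) (rm k (rm j I)) (+) b (inc v j) (rm k (rm j I))
   (+) (b (inc v k) (rm k (rm j I)) (+) b v (rm k (rm j I)))).
rewrite -[RHS](@sym_sum2 A I); first last.
- by move=> j; rewrite /A eqxx.
- move=> j k; rewrite /A eq_sym; case: eqVneq => //= jk.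
  rewrite rm_comm inc_comm // !addbA; congr (_ (+) _).
  by rewrite -!addbA [X in _ (+) X]addbC.
apply: eq_bigr => j _; rewrite -big_split /= big_filter big_mkcond /=.
by apply: eq_bigr => k _; rewrite /A; case: eqVneq.
Qed.

Lemma eq_cobound b b' v I : (forall v I, b v I = b' v I) -> cobound b v I = cobound b' v I.
Proof. by move=> bb'; apply: eq_bigr => j _; rewrite !bb'. Qed.

(** Leibniz rule for a 0-cochain times a cocycle: the term in which the coboundary falls on [cup L]
    vanishes, so the product is itself a coboundary. *)
Lemma cup_cobound s L v I :
  (forall v I, cobound (cup L) v I = false) ->
  cup (s :: L) v I = cobound (fun v I => s v && cup L v I) v I.
Proof.
move=> cL; have := cL v I; rewrite /cobound /= => c0.
transitivity ((\big[addb/false]_(j <- I) ((s (inc v j) (+) s v) && cup L (inc v j) (rm j I)))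
   (+) (s v && \big[addb/false]_(j <- I) (cup L (inc v j) (rm j I) (+) cup L v (rm j I)))).
  by rewrite c0 andbF addbF.
rewrite (big_morph (andb (s v)) (andb_addr (s v)) (andbF _)) -big_split /=.
apply: eq_bigr => j _.
by case: (s v); case: (s _); case: (cup _ _ _); case: (cup _ _ _).
Qed.

Lemma cobound_cup L v I : cobound (cup L) v I = false.
Proof.
elim: L v I => [|s L IH] v I.
  by rewrite /cobound big1 // => j _ /=; rewrite addbb.
rewrite (eq_cobound (b' := cobound (fun v I => s v && cup L v I))) ?cobound_cobound //.
by move=> {}v {}I; apply: cup_cobound.
Qed.

Fixpoint boxsum N I (F : (nat -> nat) -> bool) w : bool :=
  if I is i :: I' then \big[addb/false]_(t < N) boxsum N I' F (upd w i t) else F w.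

Lemma eq_boxsum N I F G w :
  (forall v, (forall k, k \notin I -> v k = w k) -> F v = G v) ->
  boxsum N I F w = boxsum N I G w.
Proof.
elim: I w => [|i I IH] w FG /=; first exact: FG.
apply: eq_bigr => t _; apply: IH => v hv; apply: FG => k.
rewrite inE negb_or => /andP[ki kI]; rewrite hv // /upd (negPf ki) //.
Qed.

Lemma boxsum_add N I F G w :
  boxsum N I (fun v => F v (+) G v) w = boxsum N I F w (+) boxsum N I G w.
Proof.
elim: I w => [|i I IH] w //=.
by under eq_bigr do rewrite IH; rewrite big_split.
Qed.

Lemma boxsum0 N I w : boxsum N I (fun=> false) w = false.
Proof. by elim: I w => [|i I IH] w //=; rewrite big1. Qed.

Lemma boxsum_big N I J (F : nat -> (nat -> nat) -> bool) w :
  boxsum N I (fun v => \big[addb/false]_(j <- J) F j v) w =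
  \big[addb/false]_(j <- J) boxsum N I (F j) w.
Proof.
elim: J => [|j J IH].
  rewrite big_nil -[RHS](boxsum0 N I w).
  by apply: eq_boxsum => v _; rewrite big_nil.
rewrite big_cons -IH -boxsum_add.
by apply: eq_boxsum => v _; rewrite big_cons.
Qed.

Lemma boxsum_rm N I F w j : uniq I -> j \in I ->
  boxsum N I F w = \big[addb/false]_(t < N) boxsum N (rm j I) F (upd w j t).
Proof.
elim: I w => //= i I IH w /andP[iI uI]; rewrite inE; case: (eqVneq j i) => /= [->|ji] jI.
  by rewrite /rm; have /all_filterP -> : all (fun k => k != i) I by
    apply/allP => k kI; apply: contraNneq iI => <-.
rewrite -/(rm j I); under eq_bigr do rewrite IH //.
rewrite exchange_big /=; apply: eq_bigr => t _; apply: eq_bigr => u _.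
by rewrite upd_comm // eq_sym.
Qed.

Lemma boxsum_inc N I F w j : j \notin I ->
  boxsum N I (fun v => F (inc v j)) w = boxsum N I F (inc w j).
Proof.
elim: I w => //= i I IH w; rewrite inE negb_or => /andP[ji jI].
apply: eq_bigr => t _; rewrite IH //; congr boxsum.
by rewrite /inc [RHS]upd_comm //; congr (upd _ _ _.+1); rewrite /upd (negPf ji).
Qed.

Lemma addb_telescope (a : nat -> bool) N :
  \big[addb/false]_(t < N) (a t.+1 (+) a t) = a N (+) a 0.
Proof.
elim: N => [|N IH]; first by rewrite big_ord0 addbb.
by rewrite big_ord_recr /= IH; case: (a N); case: (a 0); case: (a N.+1).
Qed.

Lemma mem_rm j I : j \notin rm j I.
Proof. by rewrite mem_filter eqxx. Qed.

(** Stokes in direction j: the sum telescopes and leaves the two opposite faces. *)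
Lemma boxsum_face N I F w j : uniq I -> j \in I ->
  boxsum N I (fun v => F (inc v j) (+) F v) w =
  boxsum N (rm j I) F (upd w j N) (+) boxsum N (rm j I) F (upd w j 0).
Proof.
move=> uI jI; rewrite (boxsum_rm _ _ _ uI jI).
under eq_bigr do rewrite boxsum_add boxsum_inc ?mem_rm //.
rewrite -(addb_telescope (fun t => boxsum N (rm j I) F (upd w j t))).
apply: eq_bigr => t _; congr (_ (+) _); congr boxsum.
by apply/funext => k; rewrite /inc /upd eqxx; case: (k == j).
Qed.

Section Labels.
Variables (N : nat) (s : nat -> (nat -> nat) -> bool).

Definition face_labels (L : seq nat) := forall i v, i \in L ->
  (v i = 0 -> s i v = false) /\ (v i = N -> s i v = true).

(** The label [s j] is constant on such a face, so its coboundary, a factor of the product, vanishes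
    on every edge of the cube. *)
Lemma cup_face L v I j : face_labels L -> j \in L -> j \notin I ->
  v j = 0 \/ v j = N -> cup [seq s i | i <- L] v I = false.
Proof.
elim: L v I => //= i L IH v I hs; rewrite inE => jL jI vj.
have vE k : k \in I -> inc v k j = v j.
  move=> kI; rewrite /inc /upd; case: eqVneq => // jk.
  by move: jI; rewrite jk kI.
rewrite big_seq big1 // => k kI.
case/orP: jL => [/eqP ji|jL]; last first.
  rewrite (IH (inc v k)) ?andbF ?vE //; last by rewrite mem_filter (negPf jI) andbF.
  by move=> l u lL; apply: hs; rewrite inE lL orbT.
have iL : i \in i :: L by rewrite inE eqxx.
have [h1 h2] := hs i v iL; have [h3 h4] := hs i (inc v k) iL.
rewrite -ji in h1 h2 h3 h4 *.
by case: vj => vj; [rewrite h1 ?h3 ?vE|rewrite h2 ?h4 ?vE].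
Qed.

(** Write the product as the coboundary of [s i] times the rest and apply Stokes. On the faces of a
    direction j other than i the rest vanishes by [cup_face]. On the face v i = 0 the label is
    false; on the face v i = N it is true, which leaves the same statement in one dimension less. *)
Lemma boxsum_cup L I w : face_labels L -> uniq L -> uniq I -> I =i L ->
  boxsum N I (fun v => cup [seq s i | i <- L] v I) w = true.
Proof.
elim: L I w => [|i L IH] I w hs.
  by case: I => // a I _ _ /(_ a); rewrite inE eqxx.
move=> /= /andP[iL uL] uI IL.
have iI : i \in I by rewrite IL inE eqxx.
have hs' : face_labels L by move=> k v kL; apply: hs; rewrite inE kL orbT.
set b := fun v J => s i v && cup [seq s i | i <- L] v J.
transitivity (boxsum N I (fun v => \big[addb/false]_(j <- I)
    (b (inc v j) (rm j I) (+) b v (rm j I))) w).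
  by apply: eq_boxsum => v _; rewrite -/(cup (s i :: _) v I) cup_cobound //; apply: cobound_cup.
rewrite boxsum_big.
transitivity (\big[addb/false]_(j <- I) (j == i)).
  apply: eq_big_seq => j jI; rewrite (boxsum_face _ (b^~ (rm j I))) //.
  case: (eqVneq j i) => [ji|ji].
    have -> : boxsum N (rm j I) (b^~ (rm j I)) (upd w j 0) = false.
      rewrite -[RHS](boxsum0 N (rm j I) (upd w j 0)); apply: eq_boxsum => v hv.
      have vj : v j = 0 by rewrite hv ?mem_rm // /upd eqxx.
      by rewrite /b; have [-> //] := hs i v (mem_head _ _); rewrite -ji.
    rewrite addbF; transitivity (boxsum N (rm j I)
        (fun v => cup [seq s i | i <- L] v (rm j I)) (upd w j N)).
      apply: eq_boxsum => v hv.
      have vj : v j = N by rewrite hv ?mem_rm // /upd eqxx.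
      by rewrite /b; have [_ -> //] := hs i v (mem_head _ _); rewrite -ji.
    apply: IH => //; first exact: filter_uniq.
    move=> k; rewrite mem_filter IL inE ji; case: eqVneq => //= ->.
    by rewrite (negPf iL).
  have jL : j \in L by move: jI; rewrite IL inE (negPf ji).
  have b0 t : t = 0 \/ t = N -> boxsum N (rm j I) (b^~ (rm j I)) (upd w j t) = false.
    move=> ht; rewrite -[RHS](boxsum0 N (rm j I) (upd w j t)); apply: eq_boxsum => v hv.
    rewrite /b (@cup_face L v _ j) ?andbF ?mem_rm //.
    by rewrite hv ?mem_rm // /upd eqxx.
  by rewrite !b0; [|left|right].
rewrite (bigD1_seq i) //= eqxx big1 // => j; exact: negPf.
Qed.

Lemma boxsum_ex I F w : boxsum N I F w ->
  exists v, [/\ forall k, k \in I -> v k < N, forall k, k \notin I -> v k = w k & F v].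
Proof.
elim: I w => [|i I IH] w /=; first by exists w.
case: (pselect (exists t : 'I_N, boxsum N I F (upd w i t))) => [[t /IH [v [h1 h2 h3]]] _|h].
  case: (boolP (i \in I)) => iI.
    exists v; split=> // k; rewrite inE; first by case/orP => [/eqP ->|]; apply: h1.
    rewrite negb_or => /andP[ki kI]; by rewrite h2 // /upd (negPf ki).
  exists v; split=> // k; rewrite inE.
    case: eqVneq => [->|_] /=; last exact: h1.
    by rewrite h2 // /upd eqxx.
  by rewrite negb_or => /andP[ki kI]; rewrite h2 // /upd (negPf ki).
rewrite big1 // => t _; apply: contra_notF h => ht; by exists t.
Qed.
End Labels.

(** A nonzero sum has a nonzero term, that is, an increasing edge path through the cube along which
    the labels of L change one after the other. *)
Lemma cup_cube L v I s : cup L v I ->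
  (exists2 i, i < size L & nth (fun=> false) L i = s) ->
  exists u u', [/\ forall k, v k <= u k <= v k + (k \in I),
                   forall k, v k <= u' k <= v k + (k \in I) & s u != s u'].
Proof.
elim: L v I => [|s0 L IH] v I /=; first by move=> _ [].
case: (pselect (exists2 j, j \in I & (s0 (inc v j) (+) s0 v) && cup L (inc v j) (rm j I))); last first.
  move=> h; rewrite big_seq big1 // => j jI; apply: contra_notF h => ?; by exists j.
case=> j jI /andP[sj cj] _.
have hinc k : v k <= inc v j k <= v k + (k \in I).
  rewrite /inc /upd; case: eqVneq => [->|_]; first by rewrite jI addn1 leqnSn leqnn.
  by rewrite leqnn leq_addr.
case=> -[|i] /= ltiL si; last first.
  case: (IH _ _ cj); first by exists i.
  have cube u : (forall k, inc v j k <= u k <= inc v j k + (k \in rm j I)) ->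
      forall k, v k <= u k <= v k + (k \in I).
    move=> hu k; have := hu k; rewrite mem_filter /inc /upd.
    case: eqVneq => [->|//]; rewrite /= jI addn0 addn1 => /andP[h1 h2].
    by rewrite (ltnW h1) h2.
  move=> u [u' [hu hu' su]]; exists u, u'; split=> //; exact: cube.
exists (inc v j), v; split=> //; first by move=> k; rewrite leqnn leq_addr.
by rewrite -si; case: (s0 _) sj; case: (s0 _).
Qed.

Lemma poincare_miranda_grid n N (s : nat -> (nat -> nat) -> bool) :
  (forall i v, i < n -> (v i = 0 -> s i v = false) /\ (v i = N -> s i v = true)) ->
  exists v, (forall k, k < n -> v k < N) /\ forall i, i < n ->
    exists u u', [/\ forall k, v k <= u k <= (v k).+1,
                     forall k, v k <= u' k <= (v k).+1, s i u = false & s i u' = true].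
Proof.
move=> hs; have hsf : face_labels N s (iota 0 n).
  by move=> i v; rewrite mem_iota add0n => /andP[_]; apply: hs.
have /boxsum_ex := boxsum_cup (fun=> 0) hsf (iota_uniq _ _) (iota_uniq _ _) (fun=> erefl).
case=> v [vN _ cv]; exists v; split=> [k kn|i ltin].
  by apply: vN; rewrite mem_iota.
have [|u [u' [hu hu' su]]] := cup_cube (s := s i) cv.
  by exists i; rewrite ?size_map ?size_iota // (nth_map 0) ?size_iota // nth_iota.
have cube w : (forall k, v k <= w k <= v k + (k \in iota 0 n)) ->
    forall k, v k <= w k <= (v k).+1.
  move=> hw k; case/andP: (hw k) => -> h /=; apply: (leq_trans h).
  by rewrite -addn1 leq_add2l leq_b1.
case E : (s i u) su; case E' : (s i u') => // _.
  by exists u', u; split=> //; apply: cube.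
by exists u, u'; split=> //; apply: cube.
Qed.

End GridCochains.

Import Order.TTheory GRing.Theory Num.Theory numFieldNormedType.Exports.
Local Open Scope classical_set_scope.
Local Open Scope ring_scope.

(** * Projections of semialgebraic sets *)

Section Projection.
Variable R : realType.
Import ordered_qelim.

Definition cenv k (y : 'cV[R]_k) : seq R := [seq y i 0 | i <- enum 'I_k].

Lemma size_cenv k (y : 'cV[R]_k) : size (cenv y) = k.
Proof. by rewrite size_map size_enum_ord. Qed.

Lemma nth_cenv k (y : 'cV[R]_k) (i : 'I_k) : (cenv y)`_i = y i 0.
Proof. by rewrite (nth_map i) ?nth_ord_enum // size_enum_ord. Qed.

Lemma cenv_col_mx k (t : R) (y : 'cV[R]_k) :
  cenv (col_mx t%:M y : 'cV_(1 + k)) = t :: cenv y.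
Proof.
apply: (@eq_from_nth _ 0) => [|i]; first by rewrite /= !size_cenv.
rewrite size_cenv => lik; rewrite (nth_cenv _ (Ordinal lik)).
case: i lik => [|i] lik /=.
  by rewrite (_ : Ordinal lik = lshift k ord0) ?col_mxEu ?mxE //; apply: val_inj.
rewrite (_ : Ordinal lik = rshift 1 (Ordinal (lik : (i < k)%N))); last exact: val_inj.
by rewrite col_mxEd -(nth_cenv _ (Ordinal (lik : (i < k)%N))).
Qed.

Fixpoint term_of_pexpr k (p : pexpr R k 1) : GRing.term R :=
  match p with
  | PConst c => GRing.Const c
  | PVar i _ => GRing.Var R i
  | PAdd p q => GRing.Add (term_of_pexpr p) (term_of_pexpr q)
  | PMul p q => GRing.Mul (term_of_pexpr p) (term_of_pexpr q)
  end.

Lemma eval_term_of_pexpr k (p : pexpr R k 1) y :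
  GRing.eval (cenv y) (term_of_pexpr p) = peval p y.
Proof. by elim: p => [c|i j|p IHp q IHq|p IHp q IHq] //=; rewrite ?IHp ?IHq // nth_cenv ord1. Qed.

Lemma rterm_term_of_pexpr k (p : pexpr R k 1) : GRing.rterm (term_of_pexpr p).
Proof. by elim: p => //= p -> q ->. Qed.

Lemma semialg_formula k (S : set 'cV[R]_k) : semialg S ->
  exists2 f, ord.rformula f & forall y, S y <-> ord.holds (cenv y) f.
Proof.
elim=> [p|S1 S2 _ [f1 r1 h1] _ [f2 r2 h2]|S1 S2 _ [f1 r1 h1] _ [f2 r2 h2]|S1 _ [f1 r1 h1]].
- exists (ord.Le (GRing.Const 0) (term_of_pexpr p)) => [|y] /=.
    exact: rterm_term_of_pexpr.
  by rewrite eval_term_of_pexpr.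
- by exists (ord.Or f1 f2) => [|y] /=; rewrite ?r1 // /setU /= h1 h2.
- by exists (ord.And f1 f2) => [|y] /=; rewrite ?r1 // /setI /= h1 h2.
- by exists (ord.Not f1) => [|y] //=; rewrite /setC /= h1.
Qed.

(** Terms have unboundedly many variables; those beyond k are read as 0, the default value in the
    evaluation of terms. *)
Definition pvar0 k (i : nat) : pexpr R k 1 :=
  if insub i is Some j then PVar R j ord0 else PConst k 1 0.

Lemma peval_pvar0 k i (y : 'cV[R]_k) : peval (pvar0 k i) y = (cenv y)`_i.
Proof.
rewrite /pvar0; case: insubP => [j _ <-|]; first by rewrite nth_cenv.
by rewrite -leqNgt => lki; rewrite nth_default ?size_cenv.
Qed.

(** Variable 0 is reserved for the coordinate to be eliminated, hence the dummy head of the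
    environment. *)
Lemma pexpr_of_term k (t : GRing.term R) : GRing.rterm t ->
  exists p : pexpr R k 1, forall y, peval p y = GRing.eval (0 :: cenv y) t.
Proof.
elim: t => //=.
- by case=> [|i] _; [exists (PConst k 1 0) | exists (pvar0 k i) => y /=; rewrite peval_pvar0].
- by move=> c _; exists (PConst k 1 c).
- by move=> c _; exists (PConst k 1 c%:R).
- move=> t1 IH1 t2 IH2 /andP[/IH1 [p1 h1] /IH2 [p2 h2]].
  by exists (PAdd p1 p2) => y /=; rewrite h1 h2.
- move=> t1 IH1 /IH1 [p1 h1].
  by exists (PMul (PConst k 1 (-1)) p1) => y /=; rewrite h1 mulN1r.
- move=> t1 IH1 n /IH1 [p1 h1].
  by exists (PMul (PConst k 1 n%:R) p1) => y /=; rewrite h1 mulr_natl.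
- move=> t1 IH1 t2 IH2 /andP[/IH1 [p1 h1] /IH2 [p2 h2]].
  by exists (PMul p1 p2) => y /=; rewrite h1 h2.
- move=> t1 IH1 n /IH1 [p1 h1]; elim: n => [|n [p IHn]].
    by exists (PConst k 1 1) => y; rewrite expr0.
  by exists (PMul p1 p) => y /=; rewrite h1 IHn exprS.
Qed.

Lemma semialg_le k (p q : pexpr R k 1) : semialg [set y | peval p y <= peval q y].
Proof.
have := sa_basic (PAdd q (PMul (PConst k 1 (-1)) p)).
by congr semialg; apply/seteqP; split=> y /=; rewrite mulN1r subr_ge0.
Qed.

Lemma semialg_qf_eval k (f : ord.formula R) : ord.qf_form f -> ord.rformula f ->
  semialg [set y : 'cV[R]_k | ord.qf_eval (0 :: cenv y) f].
Proof.
elim: f => //=.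
- move=> [] _ _.
    have := semialg_le (PConst k 1 0) (PConst k 1 0).
    by congr semialg; apply/seteqP; split=> y /=; rewrite lexx.
  have := semialg_le (PConst k 1 1) (PConst k 1 0).
  by congr semialg; apply/seteqP; split=> y /=; rewrite // ler10.
- move=> t1 t2 _ /andP[/(pexpr_of_term k) [p1 h1] /(pexpr_of_term k) [p2 h2]].
  have := sa_inter (semialg_le p1 p2) (semialg_le p2 p1).
  congr semialg; apply/seteqP; split=> y /=; rewrite !(h1, h2) eq_le.
    by case=> -> ->.
  by move=> /andP.
- move=> t1 t2 _ /andP[/(pexpr_of_term k) [p1 h1] /(pexpr_of_term k) [p2 h2]].
  have := sa_compl (semialg_le p2 p1).
  congr semialg; apply/seteqP; split=> y; rewrite /setC /= !(h1, h2) ltNge.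
    by move/negP.
  by move/negP.
- move=> t1 t2 _ /andP[/(pexpr_of_term k) [p1 h1] /(pexpr_of_term k) [p2 h2]].
  by have := semialg_le p1 p2; congr semialg; apply/seteqP; split=> y /=; rewrite !(h1, h2).
- move=> f1 IH1 f2 IH2 /andP[q1 q2] /andP[r1 r2].
  have := sa_inter (IH1 q1 r1) (IH2 q2 r2).
  congr semialg; apply/seteqP; split=> y /=; first by case=> -> ->.
  by move=> /andP.
- move=> f1 IH1 f2 IH2 /andP[q1 q2] /andP[r1 r2].
  have := sa_union (IH1 q1 r1) (IH2 q2 r2).
  by congr semialg; apply/seteqP; split=> y /=; [move/orP | move/orP].
- move=> f1 IH1 f2 IH2 /andP[q1 q2] /andP[r1 r2].
  have := sa_union (sa_compl (IH1 q1 r1)) (IH2 q2 r2).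
  congr semialg; apply/seteqP; split=> y /=; rewrite implybE.
    by case=> [/negP ->|->] //; rewrite orbT.
  by move=> /orP[/negP|]; [left | right].
- move=> f1 IH1 q1 r1.
  have := sa_compl (IH1 q1 r1).
  by congr semialg; apply/seteqP; split=> y; rewrite /setC /=; move/negP.
Qed.

(** Tarski-Seidenberg, from quantifier elimination over real closed fields. *)
Lemma semialg_proj k (S : set 'cV[R]_(1 + k)) : semialg S ->
  semialg [set y : 'cV[R]_k | exists t : R, S (col_mx t%:M y)].
Proof.
move=> /semialg_formula [f rf hf].
pose g := ord.Exists 0 f.
have rg : ord.rformula g by [].
pose h := ord.quantifier_elim (fun i bc => qe_rcf.qfr_to_formula (@qe_rcf.wproj R i bc)) g.
have /andP[qh rh] := ord.quantifier_elim_wf (@qe_rcf.wf_QE_wproj R) rg.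
have := semialg_qf_eval k qh rh.
congr semialg; apply/seteqP; split=> y /=.
  move/(ord.quantifier_elim_rformP (@qe_rcf.wf_QE_wproj R) (@qe_rcf.valid_QE_wproj R) _ rg).
  by case=> t /= ht; exists t; rewrite hf cenv_col_mx.
case=> t; rewrite hf cenv_col_mx => ht.
by apply/(ord.quantifier_elim_rformP (@qe_rcf.wf_QE_wproj R) (@qe_rcf.valid_QE_wproj R) _ rg); exists t.
Qed.

End Projection.

(** * Predicates definable by semialgebraic conditions on coordinates *)

Section Definable.
Variable R : realType.

Fixpoint psubst m n k (M : 'I_m -> 'I_n -> pexpr R k 1) (p : pexpr R m n) : pexpr R k 1 :=
  match p with
  | PConst c => PConst k 1 c
  | PVar i j => M i j
  | PAdd p q => PAdd (psubst M p) (psubst M q)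
  | PMul p q => PMul (psubst M p) (psubst M q)
  end.

Lemma peval_psubst m n k (M : 'I_m -> 'I_n -> pexpr R k 1) p y :
  peval (psubst M p) y = peval p (\matrix_(i, j) peval (M i j) y).
Proof. by elim: p => [c|i j|p IHp q IHq|p IHp q IHq] /=; rewrite ?mxE ?IHp ?IHq. Qed.

(* A point of X has coordinates [c x]; [ext c] and [extc c] adjoin quantified variables,
   placed first so that [semialg_proj] and [semialg_projc] eliminate them. *)
Definition polyf X k (c : X -> 'cV[R]_k) (F : X -> R) :=
  exists p : pexpr R k 1, forall x, F x = peval p (c x).

Definition sdef X k (c : X -> 'cV[R]_k) (P : X -> Prop) :=
  exists2 S, semialg S & forall x, P x <-> S (c x).

Definition ext X k (c : X -> 'cV[R]_k) (u : X * R) : 'cV[R]_(1 + k) :=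
  col_mx u.2%:M (c u.1).

Definition extc X m k (c : X -> 'cV[R]_k) (u : X * 'cV[R]_m) : 'cV[R]_(m + k) :=
  col_mx u.2 (c u.1).

Section Poly.
Variables (X : Type) (k : nat) (c : X -> 'cV[R]_k).

Lemma polyf_cst a : polyf c (fun=> a).
Proof. by exists (PConst k 1 a). Qed.

Lemma polyf_coord i : polyf c (fun x => c x i 0).
Proof. by exists (PVar R i ord0). Qed.

Lemma polyfD F F' : polyf c F -> polyf c F' -> polyf c (fun x => F x + F' x).
Proof. by move=> [p hp] [q hq]; exists (PAdd p q) => x /=; rewrite hp hq. Qed.

Lemma polyfM F F' : polyf c F -> polyf c F' -> polyf c (fun x => F x * F' x).
Proof. by move=> [p hp] [q hq]; exists (PMul p q) => x /=; rewrite hp hq. Qed.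

Lemma polyfN F : polyf c F -> polyf c (fun x => - F x).
Proof.
by move=> [p hp]; exists (PMul (PConst k 1 (-1)) p) => x /=; rewrite hp mulN1r.
Qed.

Lemma polyfB F F' : polyf c F -> polyf c F' -> polyf c (fun x => F x - F' x).
Proof. by move=> hF hF'; apply: polyfD => //; apply: polyfN. Qed.

Lemma polyf_sum (I : Type) (r : seq I) (F : I -> X -> R) :
  (forall i, polyf c (F i)) -> polyf c (fun x => \sum_(i <- r) F i x).
Proof.
move=> hF; elim: r => [|i r [p hp]].
  by exists (PConst k 1 0) => x; rewrite big_nil.
by have [q hq] := hF i; exists (PAdd q p) => x /=; rewrite big_cons hq hp.
Qed.

Lemma polyf_peval m n (M : X -> 'M[R]_(m, n)) p :
  (forall i j, polyf c (fun x => M x i j)) -> polyf c (fun x => peval p (M x)).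
Proof.
move=> hM; have [N hN] : exists N : 'I_m -> 'I_n -> pexpr R k 1,
    forall i j x, M x i j = peval (N i j) (c x).
  have [N hN] := choice (fun ij : 'I_m * 'I_n => hM ij.1 ij.2).
  by exists (fun i j => N (i, j)) => i j x; rewrite -(hN (i, j)).
exists (psubst N p) => x; rewrite peval_psubst.
by congr peval; apply/matrixP => i j; rewrite mxE hN.
Qed.

Lemma eq_sdef P Q : (forall x, P x <-> Q x) -> sdef c P -> sdef c Q.
Proof. by move=> PQ [S hS hP]; exists S => // x; rewrite -PQ. Qed.

Lemma sdef_and P Q : sdef c P -> sdef c Q -> sdef c (fun x => P x /\ Q x).
Proof.
move=> [S hS hP] [T hT hQ]; exists (S `&` T); first exact: sa_inter.
by move=> x; rewrite hP hQ.
Qed.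

Lemma sdef_or P Q : sdef c P -> sdef c Q -> sdef c (fun x => P x \/ Q x).
Proof.
move=> [S hS hP] [T hT hQ]; exists (S `|` T); first exact: sa_union.
by move=> x; rewrite hP hQ.
Qed.

Lemma sdef_not P : sdef c P -> sdef c (fun x => ~ P x).
Proof.
move=> [S hS hP]; exists (~` S); first exact: sa_compl.
by move=> x; rewrite hP.
Qed.

Lemma sdef_imp P Q : sdef c P -> sdef c Q -> sdef c (fun x => P x -> Q x).
Proof.
move=> hP hQ; apply: (eq_sdef _ (sdef_or (sdef_not hP) hQ)) => x.
by split=> [[nP|] //|PQ]; case: (pselect (P x)) => [/PQ|]; [right | left].
Qed.

Lemma sdef_iff P Q : sdef c P -> sdef c Q -> sdef c (fun x => P x <-> Q x).
Proof. by move=> hP hQ; apply: sdef_and; apply: sdef_imp. Qed.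

Lemma sdef_semialg m n (S : set 'M[R]_(m, n)) (M : X -> 'M[R]_(m, n)) :
  semialg S -> (forall i j, polyf c (fun x => M x i j)) -> sdef c (fun x => S (M x)).
Proof.
move=> + hM; elim=> [p|S1 S2 _ IH1 _ IH2|S1 S2 _ IH1 _ IH2|S1 _ IH1].
- have [q hq] := polyf_peval p hM.
  by exists [set y | 0 <= peval q y] => [|x /=]; [exact: sa_basic | rewrite hq].
- exact: sdef_or.
- exact: sdef_and.
- exact: sdef_not.
Qed.

Lemma sdef_le F F' : polyf c F -> polyf c F' -> sdef c (fun x => F x <= F' x).
Proof.
move=> [p hp] [q hq]; exists [set y | peval p y <= peval q y].
  exact: semialg_le.
by move=> x /=; rewrite hp hq.
Qed.

Lemma sdef_lt F F' : polyf c F -> polyf c F' -> sdef c (fun x => F x < F' x).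
Proof.
move=> hF hF'; apply: (eq_sdef _ (sdef_not (sdef_le hF' hF))) => x.
by rewrite ltNge; split => /negP.
Qed.

Lemma sdef_eq F F' : polyf c F -> polyf c F' -> sdef c (fun x => F x = F' x).
Proof.
move=> hF hF'; apply: (eq_sdef _ (sdef_and (sdef_le hF hF') (sdef_le hF' hF))) => x.
split=> [[h1 h2]|->]; last by rewrite lexx.
by apply/eqP; rewrite eq_le h1.
Qed.

Lemma sdef_cst (Q : Prop) : sdef c (fun=> Q).
Proof.
case: (pselect Q) => hQ.
  by apply: (eq_sdef _ (sdef_le (polyf_cst 0) (polyf_cst 0))) => x; rewrite lexx.
by apply: (eq_sdef _ (sdef_lt (polyf_cst 0) (polyf_cst 0))) => x; rewrite ltxx.
Qed.

Lemma sdef_ex (P : X * R -> Prop) : sdef (ext c) P -> sdef c (fun x => exists t, P (x, t)).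
Proof.
move=> [S hS hP]; exists [set y | exists t : R, S (col_mx t%:M y)].
  exact: semialg_proj.
by move=> x; split=> -[t]; [move/hP; exists t | move=> ht; exists t; apply/hP].
Qed.

Lemma sdef_all (P : X * R -> Prop) : sdef (ext c) P -> sdef c (fun x => forall t, P (x, t)).
Proof.
move=> [S hS hP]; apply: (@eq_sdef (fun x => ~ exists t, ~ P (x, t))).
  move=> x; split=> [h t|h [t]]; last exact.
  by apply: contrapT => h'; apply: h; exists t.
apply: sdef_not; apply: (sdef_ex (P := fun u => ~ P u)); exists (~` S); first exact: sa_compl.
by move=> u; rewrite hP.
Qed.

Lemma ext_inl (u : X * R) i : ext c u (rshift 1 i) 0 = c u.1 i 0.
Proof. by rewrite /ext col_mxEd. Qed.

Lemma ext_inr (u : X * R) : ext c u (lshift k ord0) 0 = u.2.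
Proof. by rewrite /ext col_mxEu mxE eqxx. Qed.

Lemma polyf_fst F : polyf c F -> polyf (ext c) (fun u => F u.1).
Proof.
move=> [p hp]; exists (psubst (fun i _ => PVar R (rshift 1 i) ord0) p) => u.
rewrite hp peval_psubst; congr peval; apply/matrixP => i j.
by rewrite mxE ord1 /= ext_inl.
Qed.

Lemma polyf_snd : polyf (ext c) snd.
Proof. by exists (PVar R (lshift k ord0) ord0) => u /=; rewrite ext_inr. Qed.

End Poly.

Lemma sdef_comp X Y k l (c : X -> 'cV[R]_k) (c' : Y -> 'cV[R]_l) (f : Y -> X) P :
  (forall i, polyf c' (fun y => c (f y) i 0)) -> sdef c P -> sdef c' (fun y => P (f y)).
Proof.
move=> hf [S hS hP]; apply: (@eq_sdef _ _ _ (fun y => S (c (f y)))).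
  by move=> y; rewrite hP.
by apply: sdef_semialg => // i j; rewrite ord1.
Qed.

Lemma polyf_comp X Y k l (c : X -> 'cV[R]_k) (c' : Y -> 'cV[R]_l) (f : Y -> X) F :
  (forall i, polyf c' (fun y => c (f y) i 0)) -> polyf c F -> polyf c' (fun y => F (f y)).
Proof.
move=> hf [p hp]; have [q hq] : polyf c' (fun y => peval p (c (f y))).
  by apply: polyf_peval => i j; rewrite ord1.
by exists q => y; rewrite hp hq.
Qed.

Lemma semialg_projc m k (S : set 'cV[R]_(m + k)) : semialg S ->
  semialg [set y : 'cV[R]_k | exists z : 'cV[R]_m, S (col_mx z y)].
Proof.
elim: m S => [|m IH] S hS.
  have E (z : 'cV[R]_0) (y : 'cV[R]_k) : col_mx z y = y.
    apply/colP => i; rewrite mxE; case: splitP => [[]//|j ij].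
    by congr (y _ _); apply: val_inj.
  have := hS; congr semialg; apply/seteqP; split=> y /= => [Sy|[z]]; last by rewrite E.
  by exists 0; rewrite E.
have E (t : R) (z : 'cV[R]_m) (y : 'cV[R]_k) :
    col_mx (col_mx t%:M z) y = col_mx t%:M (col_mx z y) :> 'cV_(1 + (m + k)).
  by rewrite col_mxA castmx_id.
have := IH _ (semialg_proj (S := S : set 'cV[R]_(1 + (m + k))) hS).
congr semialg; apply/seteqP; split=> y /=.
  by case=> z [t]; rewrite -E => Sz; exists (col_mx t%:M z).
case=> z; rewrite -[z](vsubmxK (m1 := 1)) [usubmx _]mx11_scalar E => Sz.
by eexists; eexists; exact: Sz.
Qed.

Lemma sdef_exc X m k (c : X -> 'cV[R]_k) (P : X * 'cV[R]_m -> Prop) :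
  sdef (extc c) P -> sdef c (fun x => exists z, P (x, z)).
Proof.
move=> [S hS hP]; exists [set y | exists z, S (col_mx z y)].
  exact: semialg_projc.
by move=> x; split=> -[z]; [move/hP; exists z | move=> hz; exists z; apply/hP].
Qed.

Lemma semialgP k (P : set 'cV[R]_k) : sdef id P -> semialg P.
Proof.
by move=> [S hS hP]; rewrite (_ : P = S) //; apply/seteqP; split=> x; rewrite hP.
Qed.

End Definable.

(** * Continuity relative to a set *)

Section Continuity.
Variable R : realType.

Lemma cvg_sumr (X I : Type) (F : set_system X) (FF : Filter F) (r : seq I)
    (f : I -> X -> R) (l : I -> R) : (forall i, f i x @[x --> F] --> l i) ->
  (\sum_(i <- r) f i x) @[x --> F] --> \sum_(i <- r) l i.
Proof.
move=> hf; elim: r => [|i r IH].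
  by rewrite big_nil; under eq_fun do rewrite big_nil; exact: cvg_cst.
by rewrite big_cons; under eq_fun do rewrite big_cons; exact: cvgD.
Qed.

(* The trace on S of the neighbourhood filter of a; it makes the convergence lemmas
   of MathComp-Analysis apply to the relative continuity [cont_on]. *)
Definition mnear m n (S : set 'M[R]_(m, n)) (a : 'M[R]_(m, n)) : set_system 'M[R]_(m, n) :=
  [set P | exists2 del, 0 < del & forall b, S b -> mdist2 a b < del -> P b].

Global Instance mnear_filter m n S a : Filter (@mnear m n S a).
Proof.
split; first by exists 1.
- move=> P Q [e e0 hP] [f f0 hQ]; exists (Num.min e f); first by rewrite lt_min e0.
  by move=> b Sb; rewrite lt_min => /andP[h1 h2]; split; [exact: hP | exact: hQ].
- by move=> P Q PQ [e e0 hP]; exists e => // b Sb ?; apply: PQ; exact: hP.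
Qed.

Definition scont m n (S : set 'M[R]_(m, n)) (h : 'M[R]_(m, n) -> R) :=
  forall a, S a -> h x @[x --> mnear S a] --> h a.

Lemma mdist2xx m n (a : 'M[R]_(m, n)) : mdist2 a a = 0.
Proof. by apply: big1 => i _; apply: big1 => j _; rewrite subrr expr0n. Qed.

Lemma sqr_le_mdist2 m n (a b : 'M[R]_(m, n)) i j : (a i j - b i j) ^+ 2 <= mdist2 a b.
Proof.
rewrite /mdist2 (bigD1 i) //= (bigD1 j) //= -addrA lerDl addr_ge0 //.
  by apply: sumr_ge0 => k _; rewrite sqr_ge0.
by apply: sumr_ge0 => k _; apply: sumr_ge0 => l _; rewrite sqr_ge0.
Qed.

Lemma cvg_mdist2 m n (X : Type) (F : set_system X) (FF : Filter F) (f : X -> 'M[R]_(m, n))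
    (a : 'M[R]_(m, n)) :
  (forall i j, f x i j @[x --> F] --> a i j) -> mdist2 a (f x) @[x --> F] --> (0 : R).
Proof.
move=> hf; rewrite -(mdist2xx a).
apply: cvg_sumr => i; apply: cvg_sumr => j.
by apply: cvgM; apply: cvgB => //; exact: cvg_cst.
Qed.

Section Basics.
Variables (m n : nat).
Implicit Types (S : set 'M[R]_(m, n)) (a b : 'M[R]_(m, n)).

Lemma mnear_coord S a i j : b i j @[b --> mnear S a] --> a i j.
Proof.
apply/cvgrPdist_lt => e e0; exists (e ^+ 2); first by rewrite exprn_gt0.
move=> b _ hb; rewrite -(ltr_pXn2r (n := 2)) ?nnegrE // ?ltW //.
by rewrite real_normK ?num_real // (le_lt_trans (sqr_le_mdist2 a b i j)).
Qed.

Lemma mnear_in S a : \forall b \near mnear S a, S b.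
Proof. by exists 1. Qed.

Lemma mnear_self S a (P : set 'M[R]_(m, n)) : S a -> mnear S a P -> P a.
Proof. by move=> Sa [e e0]; apply => //; rewrite mdist2xx. Qed.

Lemma mnear_sub S T a : S `<=` T -> mnear T a `<=` mnear S a.
Proof. by move=> ST P [e e0 hP]; exists e => // b /ST; exact: hP. Qed.

Lemma cont_onP p q S (f : 'M[R]_(m, n) -> 'M[R]_(p, q)) :
  cont_on S f <-> forall i j, scont S (fun b => f b i j).
Proof.
split=> [hf i j a Sa|hf a Sa e e0].
  apply/cvgrPdist_lt => e e0; have [|del d0 hd] := hf a Sa (e ^+ 2).
    by rewrite exprn_gt0.
  exists del => // b Sb /(hd b Sb) hb.
  rewrite -(ltr_pXn2r (n := 2)) ?nnegrE // ?ltW // real_normK ?num_real //.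
  by apply: le_lt_trans hb; exact: sqr_le_mdist2.
have hd : mdist2 (f a) (f x) @[x --> mnear S a] --> (0 : R).
  by apply: cvg_mdist2 => i j; exact: hf.
have [del d0 h] := cvgr_lt _ hd _ e0.
by exists del => // b Sb hb; exact: h.
Qed.

Lemma scont_cst S c : scont S (fun=> c).
Proof. by move=> a _; exact: cvg_cst. Qed.

Lemma scont_coord S i j : scont S (fun b => b i j).
Proof. by move=> a _; exact: mnear_coord. Qed.

Lemma scontD S f g : scont S f -> scont S g -> scont S (fun b => f b + g b).
Proof. by move=> hf hg a Sa; apply: cvgD; [exact: hf | exact: hg]. Qed.

Lemma scontB S f g : scont S f -> scont S g -> scont S (fun b => f b - g b).
Proof. by move=> hf hg a Sa; apply: cvgB; [exact: hf | exact: hg]. Qed.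

Lemma scontM S f g : scont S f -> scont S g -> scont S (fun b => f b * g b).
Proof. by move=> hf hg a Sa; apply: cvgM; [exact: hf | exact: hg]. Qed.

Lemma scontV S f : (forall a, S a -> f a != 0) -> scont S f -> scont S (fun b => (f b)^-1).
Proof. by move=> f0 hf a Sa; apply: cvgV; [exact: f0 | exact: hf]. Qed.

Lemma scont_norm S f : scont S f -> scont S (fun b => `|f b|).
Proof. by move=> hf a Sa; apply: cvg_norm; exact: hf. Qed.

Lemma scont_sum S (I : Type) (r : seq I) (F : I -> 'M[R]_(m, n) -> R) :
  (forall i, scont S (F i)) -> scont S (fun b => \sum_(i <- r) F i b).
Proof. by move=> hF a Sa; apply: cvg_sumr => i; exact: hF. Qed.

Lemma scont_sub S T f : S `<=` T -> scont T f -> scont S f.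
Proof.
by move=> ST hf a Sa; apply: cvg_trans (hf a (ST _ Sa)); apply: cvg_app; exact: mnear_sub.
Qed.

Lemma eq_scont S f g : (forall a, S a -> f a = g a) -> scont S f -> scont S g.
Proof.
move=> fg hf a Sa; rewrite -fg //; apply: cvg_trans (hf a Sa).
apply: near_eq_cvg; near=> b; apply: fg; near: b; exact: mnear_in.
Unshelve. all: by end_near. Qed.

Lemma scont_peval S (p : pexpr R m n) : scont S (peval p).
Proof.
elim: p => [c|i j|p IHp q IHq|p IHp q IHq] /=.
- exact: scont_cst.
- exact: scont_coord.
- exact: scontD.
- exact: scontM.
Qed.
End Basics.

Lemma mnear_map m n p q S (T : set 'M[R]_(p, q)) (f : 'M[R]_(m, n) -> 'M[R]_(p, q)) a :
  (forall b, S b -> T (f b)) -> (forall i j, scont S (fun b => f b i j)) -> S a ->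
  f x @[x --> mnear S a] --> mnear T (f a).
Proof.
move=> fT /cont_onP hf Sa P [e e0 hP]; have [d d0 hd] := hf a Sa e e0.
by exists d => // b Sb hb; apply: hP; [exact: fT | exact: hd].
Qed.

Lemma scont_comp m n p q S (T : set 'M[R]_(p, q)) (f : 'M[R]_(m, n) -> 'M[R]_(p, q)) h :
  (forall b, S b -> T (f b)) -> (forall i j, scont S (fun b => f b i j)) ->
  scont T h -> scont S (fun b => h (f b)).
Proof.
move=> fT hf hh a Sa.
by apply: (cvg_comp _ _ (mnear_map fT hf Sa)); apply: hh; exact: fT.
Qed.

Lemma bolzano_weierstrass n (u : nat -> 'rV[R]_n) lo hi :
  (forall k i, lo <= u k 0 i <= hi) ->
  exists2 a : 'rV[R]_n, forall i, lo <= a 0 i <= hi &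
    forall e, 0 < e -> forall N, exists2 k, (N <= k)%N & forall i, `|a 0 i - u k 0 i| < e.
Proof.
move=> hu; have cQ := @rV_compact R n (fun=> `[lo, hi]%classic) (fun=> @segment_compact R lo hi).
have [|a [Qa ca]] := cQ (u @ \oo) _ .
  by exists 0%N => // k _ i /=; rewrite in_itv /= hu.
exists a => [i|e e0 N]; first by have := Qa i; rewrite /= in_itv.
have [|//|b [[k Nk <-] hb]] := ca [set u k | k in [set k | (N <= k)%N]] (ball a e).
- by exists N => // k Nk; exists k.
- exact: nbhsx_ballx.
by exists k => // i; case: hb => _ /(_ 0 i).
Qed.

End Continuity.

(** * Invariance of dimension *)

Section InvarianceOfDimension.
Variable R : realType.

Lemma mnear_sup m n (S : set 'M[R]_(m, n)) a (P : set 'M[R]_(m, n)) : mnear S a P ->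
  exists2 e, 0 < e & forall b, S b -> (forall i j, `|a i j - b i j| < e) -> P b.
Proof.
move=> [d d0 hd]; pose c : R := 1 + (m * n)%:R.
have c0 : 0 < c by rewrite ltr_pwDl ?ler0n.
(* A radius at most 1 dominates its square, so the squares of the m n entries sum to at most m n
   times the radius, which is less than c times it. *)
exists (Num.min 1 (d / c)); first by rewrite lt_min ltr01 divr_gt0.
move=> b Sb hb; apply: hd => //.
set e := Num.min _ _ in hb; have e0 : 0 < e by rewrite lt_min ltr01 divr_gt0.
have e1 : e <= 1 by rewrite ge_min lexx.
have ed : e <= d / c by rewrite ge_min lexx orbT.
apply: (@le_lt_trans _ _ (\sum_(i < m) \sum_(j < n) e)).
  apply: ler_sum => i _; apply: ler_sum => j _.
  rewrite -real_normK ?num_real //; have := hb i j; have := normr_ge0 (a i j - b i j).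
  move: (`|_|) => r r0 re; nra.
rewrite !sumr_const !card_ord -mulrnA -mulr_natl mulnC.
apply: (@lt_le_trans _ _ (c * e)); first by rewrite /c mulrDl mul1r ltrDr.
by rewrite mulrC -ler_pdivlMr.
Qed.

Definition dist1 k (a b : 'rV[R]_k) := \sum_(j < k) `|a 0 j - b 0 j|.

Lemma dist1_triangle k (a b c : 'rV[R]_k) : dist1 a c <= dist1 a b + dist1 b c.
Proof. by rewrite -big_split; apply: ler_sum => j _; exact: ler_distD. Qed.

Lemma dist1C k (a b : 'rV[R]_k) : dist1 a b = dist1 b a.
Proof. by apply: eq_bigr => j _; rewrite distrC. Qed.

Lemma dist1_ge0 k (a b : 'rV[R]_k) : 0 <= dist1 a b.
Proof. by apply: sumr_ge0 => j _. Qed.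

Lemma dist1xx k (a : 'rV[R]_k) : dist1 a a = 0.
Proof. by apply: big1 => j _; rewrite subrr normr0. Qed.

Lemma le_dist1 k (a b : 'rV[R]_k) j : `|a 0 j - b 0 j| <= dist1 a b.
Proof. by rewrite /dist1 (bigD1 j) //= lerDl sumr_ge0. Qed.

Lemma dist1_le k (a b : 'rV[R]_k) e : (forall j, `|a 0 j - b 0 j| <= e) ->
  dist1 a b <= k%:R * e.
Proof.
move=> h; apply: (le_trans (ler_sum _ (fun j _ => h j))).
by rewrite sumr_const card_ord mulr_natl.
Qed.

(** A compact part of the open cube, on which the estimates for an embedding can be made uniform. *)
Definition midcube n : set 'rV[R]_n := [set a | forall i, 1 / 4 <= a 0 i <= 3 / 4].

Lemma midcube_cube n (a : 'rV[R]_n) : midcube a -> cube a.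
Proof. by move=> ha i; have := ha i; lra. Qed.

(** Compactness applied to the concatenated vectors gives the two sequences cluster points along
    common indices. *)
Lemma midcube_cluster2 n (u v : nat -> 'rV[R]_n) :
  (forall k, midcube (u k)) -> (forall k, midcube (v k)) ->
  exists a b, [/\ midcube a, midcube b & forall e, 0 < e -> forall N, exists2 k, (N <= k)%N &
    (forall i, `|a 0 i - u k 0 i| < e) /\ (forall i, `|b 0 i - v k 0 i| < e)].
Proof.
move=> hu hv; have [k i|c hc clc] := @bolzano_weierstrass R (n + n)
    (fun k => row_mx (u k) (v k)) (1 / 4) (3 / 4).
  by case: (split_ordP i) => j ->; rewrite ?row_mxEl ?row_mxEr; [exact: hu | exact: hv].
exists (lsubmx c), (rsubmx c); split=> [i|i|e e0 N]; rewrite ?mxE; try exact: hc.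
have [k Nk hk] := clc e e0 N; exists k => //; split=> i; rewrite mxE.
  by have := hk (lshift n i); rewrite row_mxEl.
by have := hk (rshift n i); rewrite row_mxEr.
Qed.

(** * Embeddings of the open n-cube into the open k-cube *)

Section Embedding.
Variables (n k : nat) (phi : 'rV[R]_n -> 'rV[R]_k).
Hypothesis phi_cont : cont_on (@cube R n) phi.
Hypothesis phi_cube : forall y, cube y -> cube (phi y).
Hypothesis phi_inj : forall y z, cube y -> cube z -> phi y = phi z -> y = z.

Lemma phi_near a e : cube a -> 0 < e -> exists2 d, 0 < d &
  forall b, cube b -> (forall i, `|a 0 i - b 0 i| < d) -> dist1 (phi a) (phi b) < e.
Proof.
move=> ca e0; have h : dist1 (phi a) (phi x) @[x --> mnear (@cube R n) a] --> (0 : R).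
  rewrite -(dist1xx (phi a)); apply: cvg_sumr => j; apply: cvg_norm; apply: cvgB.
    exact: cvg_cst.
  by move/cont_onP: phi_cont; apply.
have [d d0 hd] := mnear_sup (cvgr_lt _ h _ e0).
by exists d => // b cb hb; apply: hd => // i j; rewrite ord1.
Qed.

Lemma phi_unif e : 0 < e -> exists2 d, 0 < d & forall a b, midcube a -> midcube b ->
  (forall i, `|a 0 i - b 0 i| < d) -> dist1 (phi a) (phi b) < e.
Proof.
move=> e0; apply: contrapT => hN.
have /choice [f hf] : forall m : nat, exists ab : 'rV[R]_n * 'rV[R]_n,
    [/\ midcube ab.1, midcube ab.2, forall i, `|ab.1 0 i - ab.2 0 i| < m.+1%:R^-1 &
        e <= dist1 (phi ab.1) (phi ab.2)].
  move=> m; apply: contrapT => h; apply: hN; exists m.+1%:R^-1; first by rewrite invr_gt0 ltr0n.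
  move=> a b ha hb hab; rewrite ltNge; apply/negP => ?; apply: h.
  by exists (a, b).
have [||a [b [ha hb /= cl]]] := @midcube_cluster2 _ (fun m => (f m).1) (fun m => (f m).2).
- by move=> m; case: (hf m).
- by move=> m; case: (hf m).
have ab : a = b.
  apply/rowP => i; apply/eqP; rewrite -subr_eq0 -normr_le0; apply/ler_addgt0Pl => d d0.
  rewrite addr0; pose N := Num.bound (3 / d).
  have [|m Nm [h1 h2]] := cl (d / 3) _ N; first by lra.
  have [_ _ /(_ i) h3 _] := hf m.
  have h4 : m.+1%:R^-1 < d / 3.
    rewrite -[X in _ < X]invf_div ltf_pV2 ?posrE ?ltr0n // ?divr_gt0 //.
    apply: (lt_le_trans (archi_boundP _)); first by rewrite divr_ge0 // ltW.
    by rewrite ler_nat; apply: (leq_trans Nm).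
  have {}h1 := h1 i; have {}h2 := h2 i; have {}h3 := lt_trans h3 h4.
  apply: (le_trans (ler_distD ((f m).1 0 i) _ _)).
  apply: (le_trans (lerD (lexx _) (ler_distD ((f m).2 0 i) _ _))).
  rewrite [X in _ + (_ + X)]distrC; lra.
have e2 : 0 < e / 2 by lra.
have [d d0 hd] := phi_near (midcube_cube ha) e2.
have [m _ [h1 h2]] := cl d d0 0%N.
have [ma mb _ h3] := hf m.
have {}h1 := hd _ (midcube_cube ma) h1.
rewrite -ab in h2; have {}h2 := hd _ (midcube_cube mb) h2.
have := dist1_triangle (phi (f m).1) (phi a) (phi (f m).2).
rewrite [dist1 _ (phi a)]dist1C; lra.
Qed.

(** Pairs of distant points with ever closer images would cluster at a pair with equal images, which
    injectivity makes a single point. *)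
Lemma phi_inv_unif e : 0 < e -> exists2 d, 0 < d & forall a b, midcube a -> midcube b ->
  dist1 (phi a) (phi b) < d -> forall i, `|a 0 i - b 0 i| < e.
Proof.
move=> e0; apply: contrapT => hN.
have /choice [f hf] : forall m : nat, exists ab : 'rV[R]_n * 'rV[R]_n,
    [/\ midcube ab.1, midcube ab.2, dist1 (phi ab.1) (phi ab.2) < m.+1%:R^-1 &
        exists i, e <= `|ab.1 0 i - ab.2 0 i|].
  move=> m; apply: contrapT => h; apply: hN; exists m.+1%:R^-1; first by rewrite invr_gt0 ltr0n.
  move=> a b ha hb hab i; rewrite ltNge; apply/negP => ?; apply: h.
  by exists (a, b); split=> //; exists i.
have [||a [b [ha hb /= cl]]] := @midcube_cluster2 _ (fun m => (f m).1) (fun m => (f m).2).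
- by move=> m; case: (hf m).
- by move=> m; case: (hf m).
have ab : a = b.
  apply: phi_inj; [exact: midcube_cube | exact: midcube_cube|].
  apply/rowP => i; apply/eqP; rewrite -subr_eq0 -normr_le0; apply/ler_addgt0Pl => d d0.
  rewrite addr0; pose N := Num.bound (3 / d).
  have d3 : 0 < d / 3 by lra.
  have [d1 d10 hd1] := phi_near (midcube_cube ha) d3.
  have [d2 d20 hd2] := phi_near (midcube_cube hb) d3.
  have [|m Nm [h1 h2]] := cl (Num.min d1 d2) _ N; first by rewrite lt_min d10.
  have [ma mb h3 _] := hf m.
  have h4 : m.+1%:R^-1 < d / 3.
    rewrite -[X in _ < X]invf_div ltf_pV2 ?posrE ?ltr0n // ?divr_gt0 //.
    apply: (lt_le_trans (archi_boundP _)); first by rewrite divr_ge0 // ltW.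
    by rewrite ler_nat; apply: (leq_trans Nm).
  have {}h1 : dist1 (phi a) (phi (f m).1) < d / 3.
    apply: hd1 => [|j]; first exact: midcube_cube.
    by apply: (lt_le_trans (h1 j)); rewrite ge_min lexx.
  have {}h2 : dist1 (phi b) (phi (f m).2) < d / 3.
    apply: hd2 => [|j]; first exact: midcube_cube.
    by apply: (lt_le_trans (h2 j)); rewrite ge_min lexx orbT.
  apply: (le_trans (le_dist1 _ _ i)).
  apply: (le_trans (dist1_triangle _ (phi (f m).1) _)).
  apply: (le_trans (lerD (lexx _) (dist1_triangle _ (phi (f m).2) _))).
  rewrite [X in _ + (_ + X)]dist1C; have {}h3 := lt_trans h3 h4; lra.
have e2 : 0 < e / 2 by lra.
have [m _ [h1 h2]] := cl (e / 2) e2 0%N.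
have [_ _ _ [i h3]] := hf m.
have := ler_distD (a 0 i) ((f m).1 0 i) ((f m).2 0 i).
have {}h1 := h1 i; have {}h2 := h2 i; rewrite -ab in h2; rewrite distrC in h1; lra.
Qed.

(* [h i] is the Pasch-Hausdorff envelope of the i-th coordinate of phi^-1. *)
Lemma lipschitz_inverse e : 0 < e -> exists M (h : 'I_n -> 'rV[R]_n -> R), [/\ (0 < M)%N,
  forall i a, midcube a -> a 0 i - e <= h i a <= a 0 i &
  forall i a b, midcube a -> midcube b -> h i a <= h i b + M%:R * dist1 (phi a) (phi b)].
Proof.
move=> e0; have [d d0 hd] := phi_inv_unif e0.
(* With M d at least 1, a point whose image is at distance d or more costs more than coordinates in
   [midcube] can differ, so it cannot bring the infimum below the coordinate of a. *)
pose M := Num.bound d^-1.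
have M0 : 0 < M%:R :> R by apply: (lt_trans _ (archi_boundP _)); rewrite ?invr_gt0 ?invr_ge0 ?ltW.
have Md : 1 <= M%:R * d.
  by rewrite -ler_pdivrMr // div1r ltW // archi_boundP // invr_ge0 ltW.
pose E i a : set R := [set w 0 i + M%:R * dist1 (phi a) (phi w) | w in @midcube n].
have lbE i a : has_lbound (E i a).
  exists 0 => _ [w hw <-]; rewrite addr_ge0 ?mulr_ge0 ?dist1_ge0 ?ltW //.
  by have /andP[+ _] := hw i; lra.
exists M, (fun i a => inf (E i a)); split; first by rewrite -(ltr0n R).
  move=> i a ha; apply/andP; split; last first.
    by apply: (ge_inf (lbE i a)); exists a => //; rewrite dist1xx mulr0 addr0.
  apply: lb_le_inf; first by eexists; exists a => //.
  move=> _ [w hw <-]; case: (ltP (dist1 (phi a) (phi w)) d) => [lt_d|le_d].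
    have := hd _ _ ha hw lt_d i; rewrite ltr_norml => /andP[_].
    have : 0 <= M%:R * dist1 (phi a) (phi w) by rewrite mulr_ge0 ?dist1_ge0 ?ltW.
    lra.
  have : M%:R * d <= M%:R * dist1 (phi a) (phi w) by rewrite ler_pM2l.
  have := ha i; have := hw i; lra.
move=> i a b ha hb; rewrite -lerBlDr; apply: lb_le_inf; first by eexists; exists b.
move=> _ [w hw <-]; rewrite lerBlDr.
apply: (@le_trans _ _ (w 0 i + M%:R * dist1 (phi a) (phi w))).
  by apply: (ge_inf (lbE i a)); exists w.
rewrite -addrA lerD2l -mulrDr ler_pM2l // addrC; exact: dist1_triangle.
Qed.

(** Poincare-Miranda for the labels [c i < h i] on a grid in [midcube]: in the cube found, each
    [h i] lies on both sides of [c i], and the Lipschitz bound controls its variation there. The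
    boundary conditions hold because [h i] is at most 1/4 on one face and at least 11/16 on the
    opposite one, while [c i] lies in [3/8, 5/8]. *)
Lemma approx_surjective M (h : 'I_n -> 'rV[R]_n -> R) eta (c : 'I_n -> R) : (0 < M)%N ->
  (forall i a, midcube a -> a 0 i - 1 / 16 <= h i a <= a 0 i) ->
  (forall i a b, midcube a -> midcube b -> h i a <= h i b + M%:R * dist1 (phi a) (phi b)) ->
  0 < eta -> (forall i, 3 / 8 <= c i <= 5 / 8) ->
  exists2 a, midcube a & forall i, `|h i a - c i| <= M%:R * eta.
Proof.
move=> M0 hh hlip eta0 hc; have [d d0 hd] := phi_unif eta0.
pose N := (Num.bound d^-1).+1.
have N0 : 0 < N%:R :> R by rewrite ltr0n.
have Nd : (2 * N%:R)^-1 < d.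
  rewrite -[X in _ < X]invrK ltf_pV2 ?posrE ?invr_gt0 ?mulr_gt0 //.
  have : d^-1 < N%:R.
    apply: (lt_le_trans (archi_boundP _)); first by rewrite invr_ge0 ltW.
    by rewrite ler_nat.
  by rewrite -(invr_gt0 d) in d0; lra.
(* Clamping the indices at N keeps [pt v] in [midcube] for every vertex; the mesh 1/(2N) is below
   d. *)
pose pt (v : nat -> nat) : 'rV[R]_n := \row_i (1 / 4 + (minn (v i) N)%:R / (2 * N%:R)).
have ptQ v : midcube (pt v).
  move=> i; rewrite mxE; have : (minn (v i) N)%:R / (2 * N%:R) <= 1 / 2 :> R.
    rewrite ler_pdivrMr ?mulr_gt0 // mulrA divfK ?pnatr_eq0 // mul1r ler_nat.
    exact: geq_minr.
  have : 0 <= (minn (v i) N)%:R / (2 * N%:R) :> R by rewrite divr_ge0 ?mulr_ge0.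
  move: (_ / _) => r; lra.
pose s i v := if insub i is Some j then c j < h j (pt v) else false.
have sE (i : 'I_n) v : s i v = (c i < h i (pt v)) by rewrite /s valK.
have [|v [vN hv]] := @poincare_miranda_grid n N s.
  move=> i v lti; rewrite (sE (Ordinal lti)); set j := Ordinal lti.
  have := hh j _ (ptQ v); have := hc j; rewrite mxE /= => hcj hhj.
  split=> vi; rewrite vi ?min0n ?minnn in hhj.
    by apply/negbTE; rewrite -leNgt; move: hhj; rewrite mul0r; lra.
  have E : N%:R / (2 * N%:R) = 1 / 2 :> R by field; rewrite pnatr_eq0.
  by move: hhj; rewrite E; lra.
exists (pt v) => // i.
have close u : (forall l, (v l <= u l <= (v l).+1)%N) -> dist1 (phi (pt v)) (phi (pt u)) < eta.
  move=> hu; apply: hd => // l; rewrite !mxE; apply: le_lt_trans Nd.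
  have := vN l (ltn_ord l); have /andP[h1 h2] := hu l => vlN.
  have [E|E] : u l = v l \/ u l = (v l).+1 by lia.
    by rewrite E subrr normr0 invr_ge0 mulr_ge0.
  rewrite E (minn_idPl (ltnW vlN)) (minn_idPl vlN) -[(v l).+1]addn1 natrD.
  have E' (x y : R) : 1 / 4 + x / y - (1 / 4 + (x + 1) / y) = - y^-1.
    by rewrite [(x + 1) / y]mulrDl [1 / y]div1r; move: (x / y) (y^-1) => *; lra.
  rewrite E'.
  by rewrite normrN ger0_norm // invr_ge0 mulr_ge0.
have [u [u' [hu hu' su su']]] := hv i (ltn_ord i).
rewrite sE in su; rewrite sE in su'; move/negbT: su; rewrite -leNgt => su.
have lip1 := hlip i _ _ (ptQ v) (ptQ u); have lip2 := hlip i _ _ (ptQ u') (ptQ v).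
rewrite [dist1 _ (phi (pt v))]dist1C in lip2.
have M0' : 0 < M%:R :> R by rewrite ltr0n.
have m1 : M%:R * dist1 (phi (pt v)) (phi (pt u)) <= M%:R * eta by rewrite ler_pM2l // ltW // close.
have m2 : M%:R * dist1 (phi (pt v)) (phi (pt u')) <= M%:R * eta by rewrite ler_pM2l // ltW // close.
by rewrite ler_norml; lra.
Qed.

Lemma cube_embedding_dim : (n <= k)%N.
Proof.
rewrite leqNgt; apply/negP => ltkn.
have [M [h [M0 hh hlip]]] := lipschitz_inverse (e := 1 / 16) ltac:(lra).
(* There are m^n targets, at spacing 1/(4m), and L^k = K^k m^k boxes; as m exceeds K^k, the boxes
   are fewer once n > k. The factor K makes each [h i] vary by at most 1/(16m) between points with
   images in the same box. *)
pose K := (16 * M * k.+1)%N; pose m := (K ^ k).+1; pose L := (K * m)%N.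
have M0' : 0 < M%:R :> R by rewrite ltr0n.
have m0 : 0 < m%:R :> R by rewrite ltr0n.
have L0 : (0 < L)%N by rewrite !muln_gt0 M0.
have L0' : 0 < L%:R :> R by rewrite ltr0n.
pose tgt (c : {ffun 'I_n -> 'I_m}) i : R := 3 / 8 + (c i)%:R / (4 * m%:R).
have tgtP c i : 3 / 8 <= tgt c i <= 5 / 8.
  rewrite /tgt; have : (c i)%:R / (4 * m%:R) <= 1 / 4 :> R.
    rewrite ler_pdivrMr ?mulr_gt0 // mulrA divfK ?pnatr_eq0 // mul1r ler_nat.
    exact: ltnW.
  have : 0 <= (c i)%:R / (4 * m%:R) :> R by rewrite divr_ge0 ?mulr_ge0.
  move: (_ / _) => r; lra.
(* Chosen so that M eta = 1/(16m): two approximation errors and one variation add up to 3/(16m),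
   less than the spacing of the targets. *)
pose eta : R := (16 * M%:R * m%:R)^-1.
have eta0 : 0 < eta by rewrite invr_gt0 !mulr_gt0.
have /choice [A hA] : forall c, exists a, midcube a /\ forall i, `|h i a - tgt c i| <= M%:R * eta.
  by move=> c; have [a h1 h2] := approx_surjective M0 hh hlip eta0 (tgtP c); exists a.
have boxP c (j : 'I_k) : (Num.truncn (phi (A c) 0 j * L%:R)%R < L)%N.
  have [mA _] := hA c; have /(_ j) /andP[p0 p1] := phi_cube (midcube_cube mA).
  have /andP[h1 _] : (Num.truncn (phi (A c) 0 j * L%:R))%:R <= phi (A c) 0 j * L%:R
     < (Num.truncn (phi (A c) 0 j * L%:R)).+1%:R by rewrite truncn_itv // mulr_ge0 // ltW.
  rewrite -(ltr_nat R); apply: (le_lt_trans h1).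
  by rewrite -[X in _ < X]mul1r ltr_pM2r.
pose box (c : {ffun 'I_n -> 'I_m}) : {ffun 'I_k -> 'I_L} := [ffun j => Ordinal (boxP c j)].
have [c [c' [cc' bcc']]] : exists c c', c <> c' /\ box c = box c'.
  apply: contrapT => hN; have /leq_card : injective box.
    by move=> c c' b; apply: contrapT => ?; apply: hN; exists c, c'.
  rewrite !card_ffun !card_ord; apply/negP; rewrite -ltnNge.
  rewrite /L expnMn; apply: (@leq_trans (m ^ k.+1)); last by rewrite leq_pexp2l.
  by rewrite expnS ltn_pmul2r ?expn_gt0 // /m.
have [mA hAc] := hA c; have [mA' hAc'] := hA c'.
have hd : dist1 (phi (A c)) (phi (A c')) <= k%:R * L%:R^-1.
  apply: dist1_le => j.
  have /(_ j) /andP[p0 _] := phi_cube (midcube_cube mA).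
  have /(_ j) /andP[p0' _] := phi_cube (midcube_cube mA').
  have E : Num.truncn (phi (A c) 0 j * L%:R) = Num.truncn (phi (A c') 0 j * L%:R).
    by have := congr1 (fun b : {ffun 'I_k -> 'I_L} => val (b j)) bcc'; rewrite !ffunE.
  have := truncn_itv (mulr_ge0 (ltW p0) (ltW L0')).
  have := truncn_itv (mulr_ge0 (ltW p0') (ltW L0')).
  rewrite -E -natr1; move: (Num.truncn _)%:R => r /andP[h1 h2] /andP[h3 h4].
  rewrite -[X in _ <= X]mul1r ler_pdivlMr // -[X in _ * X]gtr0_norm // -normrM ler_norml mulrBl.
  lra.
have [i ci] : exists i, c i <> c' i.
  by apply: contrapT => hN; apply: cc'; apply/ffunP => i; apply: contrapT => ?; apply: hN; exists i.
have gap : (4 * m%:R)^-1 <= `|tgt c i - tgt c' i|.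
  rewrite /tgt opprD addrACA subrr add0r -mulrBl normrM [`|_^-1|]gtr0_norm ?invr_gt0 ?mulr_gt0 //.
  rewrite ler_peMl ?invr_ge0 ?mulr_ge0 //.
  have : (c i != c' i :> nat) by apply/eqP => /val_inj.
  rewrite neq_ltn => /orP[lt|lt].
    by rewrite distrC ger0_norm ?subr_ge0 ?ler_nat ?(ltnW lt) // -natrB ?(ltnW lt) // ler1n subn_gt0.
  by rewrite ger0_norm ?subr_ge0 ?ler_nat ?(ltnW lt) // -natrB ?(ltnW lt) // ler1n subn_gt0.
have Meta : M%:R * eta = (16 * m%:R)^-1.
  by rewrite /eta; field; rewrite !pnatr_eq0 /= -lt0n.
have lipc : `|h i (A c) - h i (A c')| <= (16 * m%:R)^-1.
  have l1 := hlip i _ _ mA mA'; have l2 := hlip i _ _ mA' mA; rewrite dist1C in l2.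
  have l3 : M%:R * dist1 (phi (A c)) (phi (A c')) <= (16 * m%:R)^-1.
    apply: (@le_trans _ _ (M%:R * (k%:R / L%:R))); first by rewrite ler_pM2l.
    rewrite /L /K !natrM.
    have -> : M%:R * (k%:R / (16 * M%:R * k.+1%:R * m%:R)) = k%:R / k.+1%:R * (16 * m%:R)^-1 :> R.
      have F (a b c1 c2 : R) : a != 0 -> c1 != 0 -> c2 != 0 ->
          a * (b / (16 * a * c1 * c2)) = b / c1 * (16 * c2)^-1.
        by move=> ? ? ?; field; apply/and3P.
      by apply: F; rewrite ?pnatr_eq0 -?lt0n.
    by rewrite ler_piMl ?invr_ge0 ?mulr_ge0 // ler_pdivrMr // mul1r ler_nat.
  by rewrite ler_norml; lra.
have h1 := hAc i; have h2 := hAc' i; rewrite Meta in h1 h2.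
have gE : (4 * m%:R)^-1 = 4 * (16 * m%:R)^-1 :> R by field; rewrite pnatr_eq0.
have r0 : 0 < (16 * m%:R)^-1 :> R by rewrite invr_gt0 mulr_gt0.
move: gap h1 h2 lipc r0; rewrite gE; move: (_^-1) => r.
rewrite !ler_norml => + /andP[a1 a2] /andP[a3 a4] /andP[a5 a6] r0.
apply/negP; rewrite -ltNge ltr_norml; lra.
Qed.
End Embedding.
End InvarianceOfDimension.

(** * Cylindrical cell decomposition *)

Lemma in_cat_list (T : Type) (p : T) (s1 s2 : seq T) :
  List.In p (s1 ++ s2) <-> List.In p s1 \/ List.In p s2.
Proof. by elim: s1 => [|a s1 IH] /=; [tauto | rewrite IH; tauto]. Qed.

(** * Position of a number relative to a sorted list *)

Section Ranks.
Variable R : realType.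
Implicit Types (s : seq R) (t : R).

Definition rank s t := count (fun r => r < t) s.

Lemma nth_lt_rank s t i : sorted <%R s -> (i < size s)%N -> (nth 0 s i < t) = (i < rank s t)%N.
Proof.
elim: s i => //= a s IH i pas.
have sas : sorted <%R s by exact: path_sorted pas.
have ha : all (> a) s by apply: order_path_min pas; exact: lt_trans.
case: (ltP a t) => [lt_at|le_ta].
  by case: i => [|i] /=; rewrite /rank /= ?lt_at ?ltnS //; exact: IH.
move=> lti; rewrite /rank /= ?(ltNge a t) ?le_ta /= add0n.
have -> : count (fun r => r < t) s = 0%N.
  apply/eqP; rewrite -leqn0 leqNgt -has_count; apply/hasPn => b /(allP ha) /= ab.
  by rewrite -leNgt (le_trans le_ta) // ltW.
case: i lti => [|i] /= lti; first by apply/negbTE; rewrite -leNgt.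
apply/negbTE; rewrite -leNgt (le_trans le_ta) // ltW //.
by apply: (allP ha); rewrite mem_nth.
Qed.

Lemma rank_le_size s t : (rank s t <= size s)%N.
Proof. exact: count_size. Qed.

Lemma rank_nth s i : sorted <%R s -> (i < size s)%N -> rank s (nth 0 s i) = i.
Proof.
move=> ss lti; apply/eqP; rewrite eqn_leq; apply/andP; split.
  rewrite leqNgt; apply/negP => h; have := nth_lt_rank (nth 0 s i) ss lti.
  by rewrite ltxx h.
case: i lti => // i lti.
by rewrite -(nth_lt_rank _ ss (ltnW lti)) lt_sorted_ltn_nth // inE ltnW.
Qed.

(** This recursion turns counting into a first-order condition, for [sdef_rank]. *)
Lemma rankS s t j : sorted <%R s ->
  (j < rank s t)%N <-> exists2 r, r \in s /\ r < t & (j <= rank s r)%N.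
Proof.
move=> ss; split=> [ltj|[r [rs rt] jr]].
  have ltjs : (j < size s)%N by apply: (leq_trans ltj); exact: rank_le_size.
  exists (nth 0 s j); last by rewrite rank_nth.
  by rewrite mem_nth // nth_lt_rank.
have ltr : (index r s < size s)%N by rewrite index_mem.
rewrite -(nth_index 0 rs) (rank_nth ss ltr) in jr.
by apply: leq_ltn_trans jr _; rewrite -nth_lt_rank // nth_index.
Qed.

Lemma size_gt_rank s j : sorted <%R s ->
  (j < size s)%N <-> exists2 r, r \in s & (j <= rank s r)%N.
Proof.
move=> ss; split=> [ltj|[r rs jr]]; first by exists (nth 0 s j); rewrite ?mem_nth ?rank_nth.
have ltr : (index r s < size s)%N by rewrite index_mem.
by rewrite -(nth_index 0 rs) (rank_nth ss ltr) in jr; apply: leq_ltn_trans jr _.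
Qed.

Lemma rank_inj s t t' : sorted <%R s -> t \in s -> t' \in s -> rank s t = rank s t' -> t = t'.
Proof.
move=> ss ts ts'; rewrite -{1}(nth_index 0 ts) -{1}(nth_index 0 ts') !rank_nth ?index_mem //.
by move=> E; rewrite -(nth_index 0 ts) E nth_index.
Qed.

Lemma rank_gap s t t' r : sorted <%R s -> rank s t = rank s t' ->
  t \notin s -> r \in s -> ~~ (t <= r < t').
Proof.
move=> ss E ts rs; apply/negP => /andP[tr rt'].
have : (rank s t <= rank s r)%N.
  by apply: sub_count => a /= at_; apply: (lt_le_trans at_).
have : (rank s r < rank s t')%N by apply/rankS => //; exists r.
by rewrite -E => h1 h2; have := leq_trans h1 h2; rewrite ltnn.
Qed.

End Ranks.

(** * Roots of a family of polynomials along the first coordinate *)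

Section Fibers.
Variables (R : realType) (n : nat).
Local Notation cns t x := (col_mx (t%:M : 'M[R]_1) x : 'cV[R]_(1 + n)).
Implicit Types (p q : pexpr R (1 + n) 1) (x : 'cV[R]_n) (t : R).

(* p as a polynomial in the first coordinate, the others being those of x. *)
Fixpoint ppoly p x : {poly R} :=
  match p with
  | PConst c => c%:P
  | PVar i _ => if fintype.split i is inr j then (x j 0)%:P else 'X
  | PAdd p q => ppoly p x + ppoly q x
  | PMul p q => ppoly p x * ppoly q x
  end.

Fixpoint pder p : pexpr R (1 + n) 1 :=
  match p with
  | PConst _ => PConst (1 + n) 1 0
  | PVar i _ => PConst (1 + n) 1 (if fintype.split i is inr j then 0 else 1)
  | PAdd p q => PAdd (pder p) (pder q)
  | PMul p q => PAdd (PMul (pder p) q) (PMul p (pder q))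
  end.

(** A bound for [size], one more than the degree, that is uniform in x. *)
Fixpoint pdeg p : nat :=
  match p with
  | PConst _ => 1
  | PVar _ _ => 2
  | PAdd p q => maxn (pdeg p) (pdeg q)
  | PMul p q => pdeg p + pdeg q
  end.

Lemma horner_ppoly p x t : (ppoly p x).[t] = peval p (cns t x).
Proof.
elim: p => [c|i j|p IHp q IHq|p IHp q IHq] /=; rewrite ?hornerE ?IHp ?IHq //.
by rewrite ord1 mxE; case: fintype.split => k; rewrite ?hornerE // ord1 mxE eqxx.
Qed.

Lemma ppoly_pder p x : ppoly (pder p) x = (ppoly p x)^`().
Proof.
elim: p => [c|i j|p IHp q IHq|p IHp q IHq] /=.
- by rewrite derivC polyC0.
- by case: fintype.split => k; rewrite ?derivX ?derivC.
- by rewrite IHp IHq derivD.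
- by rewrite IHp IHq derivM.
Qed.

Lemma size_ppoly p x : (size (ppoly p x) <= pdeg p)%N.
Proof.
elim: p => [c|i j|p IHp q IHq|p IHp q IHq] /=.
- exact: size_polyC_leq1.
- by case: fintype.split => k; rewrite ?size_polyX // (leq_trans (size_polyC_leq1 _)).
- apply: (leq_trans (size_polyD _ _)); rewrite geq_max.
  by rewrite (leq_trans IHp) ?leq_maxl // (leq_trans IHq) ?leq_maxr.
- by apply: (leq_trans (size_polyMleq _ _)); apply: (leq_trans (leq_pred _)); exact: leq_add.
Qed.

(** Nonvanishing in a form expressible through [peval]; the witness lies beyond all roots. *)
Lemma poly_neq0P (p : {poly R}) : p != 0 <-> exists s, p.[s] <> 0.
Proof.
split=> [p0|[s ps]]; last by apply/eqP => p0; rewrite p0 horner0 in ps.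
exists (cauchy_bound p); apply/eqP.
by apply: (ge_cauchy_bound p0); rewrite in_itv /= lexx.
Qed.

(** The closure may stop only at members that are constant on every fibre. A member that has a root
    on some fibre without vanishing there therefore has its derivative in the family. *)
Definition deriv_closed (F : seq (pexpr R (1 + n) 1)) := forall p, List.In p F ->
  (forall x, (size (ppoly p x) <= 1)%N) \/ List.In (pder p) F.

Lemma deriv_closure (Ps : seq (pexpr R (1 + n) 1)) :
  exists2 F, deriv_closed F & forall p, List.In p Ps -> List.In p F.
Proof.
have closure1 b p : (forall x, (size (ppoly p x) <= b.+1)%N) ->
    exists2 F, deriv_closed F & List.In p F.
  elim: b p => [|b IH] p hp.
    by exists [:: p] => [q [<-|[]]|]; [left | left].
  have [|F cF hF] := IH (pder p).
    by move=> x; rewrite ppoly_pder size_deriv -subn1 leq_subLR add1n.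
  exists (p :: F) => [q [<-|/cF [|]]|]; last by left.
  - by right; right.
  - by left.
  - by right; right.
elim: Ps => [|p Ps [F cF hF]]; first by exists [::].
have [|F' cF' hF'] := closure1 (pdeg p) p.
  by move=> x; rewrite (leq_trans (size_ppoly p x)).
exists (F' ++ F) => q; last first.
  by move=> /= [<-|/hF h]; apply/in_cat_list; [left | right].
move=> /in_cat_list [/cF'|/cF] [h|h]; [by left| | by left|];
  right; apply/in_cat_list; by [left | right].
Qed.

Section Family.
Variable F : seq (pexpr R (1 + n) 1).
Hypothesis F_closed : deriv_closed F.

(** Members that vanish identically on the fibre of x are left out, so that the product has finitely
    many roots. *)
Definition prodp x := \prod_(p <- F | ppoly p x != 0) ppoly p x.
Definition xi x := rootsR (prodp x).

Lemma prodp_neq0 x : prodp x != 0.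
Proof. by rewrite /prodp; elim/big_ind: _ => //; [exact: oner_neq0 | move=> *; exact: mulf_neq0]. Qed.

Lemma sorted_xi x : sorted <%R (xi x).
Proof. exact: sorted_roots. Qed.

Lemma mem_xi x t : (t \in xi x) <->
  exists p, [/\ List.In p F, ppoly p x != 0 & root (ppoly p x) t].
Proof.
have -> : (t \in xi x) = root (prodp x) t.
  by have /(_ t) := roots_on_rootsR (prodp_neq0 x); rewrite in_itv /= => <-.
rewrite /prodp; elim: (F) => [|p F' IH].
  by rewrite big_nil (negPf (root1 _)); split=> // -[p []].
rewrite big_cons; case: ifPn => [p0|/negPn /eqP p0].
  rewrite rootM; split=> [/orP[rp|/IH [q [qF q0 rq]]]|[q [[<-|qF] q0 rq]]].
  - by exists p; split=> //; left.
  - by exists q; split=> //; right.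
  - by rewrite rq.
  - by apply/orP; right; apply/IH; exists q.
rewrite IH; split=> [[q [qF q0 rq]]|[q [[qp|qF] q0 rq]]].
- by exists q; split=> //; right.
- by rewrite -qp p0 eqxx in q0.
- by exists q.
Qed.

Lemma size_xi x : (size (xi x) <= \sum_(p <- F) pdeg p)%N.
Proof.
have h : (size (xi x) < size (prodp x))%N.
  apply: max_poly_roots; first exact: prodp_neq0.
    by apply/allP => t; have /(_ t) := roots_on_rootsR (prodp_neq0 x); rewrite in_itv /= => ->.
  exact: uniq_roots.
rewrite -ltnS; apply: (leq_trans h); rewrite /prodp.
elim: (F) => [|p F' IH]; first by rewrite !big_nil size_poly1.
rewrite !big_cons; case: ifP => _; last by apply: (leq_trans IH); rewrite ltnS leq_addl.
apply: (leq_trans (size_polyMleq _ _)).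
rewrite -subn1 leq_subLR; have := size_ppoly p x; move: IH.
move: (size _) (size _) (pdeg p) (\sum_(_ <- _) _)%N => a b c e; lia.
Qed.

(** Pass to derivatives until the next one is nonzero at t. The size drops each time, and a nonzero
    polynomial with a root is not constant, so its derivative is again nonzero and in the family. *)
Lemma simple_root x t : t \in xi x -> exists q,
  [/\ List.In q F, root (ppoly q x) t & (ppoly q x)^`().[t] != 0].
Proof.
move=> /mem_xi [p [pF p0 rp]].
have [b] := ubnP (size (ppoly p x)); elim: b p pF p0 rp => // b IH p pF p0 rp lt_b.
have [d0|d0] := eqVneq ((ppoly p x)^`().[t]) 0; last by exists p.
have gt1 : (1 < size (ppoly p x))%N by exact: root_size_gt1 p0 rp.
have [/(_ x)|dF] := F_closed pF; first by rewrite leqNgt gt1.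
apply: (IH (pder p)) => //; rewrite ppoly_pder.
- by rewrite -size_poly_gt0 size_deriv -subn1 subn_gt0.
- by rewrite /root d0.
- by apply: leq_trans (_ : (size (ppoly p x) <= b)%N); rewrite ?lt_size_deriv.
Qed.

(** Dividing q by X - t leaves a factor that is nonzero at t and hence keeps its sign nearby, while
    X - t changes sign. *)
Lemma sign_change (q : {poly R}) t e : root q t -> q^`().[t] != 0 -> 0 < e ->
  exists2 d, 0 < d < e & q.[t - d] * q.[t + d] < 0.
Proof.
move=> /factor_theorem [u ->]; rewrite derivM derivXsubC !hornerE subrr mulr0 add0r => u0 e0.
have u0' : 0 < `|u.[t]| by rewrite normr_gt0.
have [d d0 hd] := poly_cont t u u0'.
pose f := Num.min d e / 2.
have m0 : 0 < Num.min d e by rewrite lt_min d0.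
have m1 : Num.min d e <= d by rewrite ge_min lexx.
have m2 : Num.min d e <= e by rewrite ge_min lexx orbT.
have fd : f < d by rewrite /f; lra.
have fe : f < e by rewrite /f; lra.
have f0 : 0 < f by rewrite /f; lra.
exists f; first by rewrite f0.
have hp : `|u.[t + f] - u.[t]| < `|u.[t]| by apply: hd; rewrite addrAC subrr add0r gtr0_norm.
have hm : `|u.[t - f] - u.[t]| < `|u.[t]|.
  by apply: hd; rewrite addrAC subrr add0r normrN gtr0_norm.
have uu : 0 < u.[t - f] * u.[t + f].
  move: hp hm; case: (ltrgtP u.[t] 0) u0 => // [ut|ut] _.
    rewrite (ltr0_norm ut) !ltr_norml => /andP[h1 h2] /andP[h3 h4].
    by rewrite nmulr_lgt0; lra.
  rewrite (gtr0_norm ut) !ltr_norml => /andP[h1 h2] /andP[h3 h4].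
  by rewrite mulr_gt0; lra.
have E y : (u * ('X - t%:P)).[y] = u.[y] * (y - t) by rewrite hornerM hornerXsubC.
rewrite !E (_ : _ * _ = - (f ^+ 2 * (u.[t - f] * u.[t + f]))); last by ring.
by rewrite oppr_lt0 mulr_gt0 ?exprn_gt0.
Qed.

Lemma scont_cns S p t : scont S (fun x => peval p (cns t x)).
Proof.
apply: (@scont_comp _ _ _ _ _ _ setT (fun x => cns t x) (peval p)) => //.
  move=> i j; under eq_fun do rewrite mxE; case: fintype.split => k.
    by apply: scont_cst.
  exact: scont_coord.
exact: scont_peval.
Qed.

(** The sign change at a simple root is an open condition on the parameter, and the intermediate
    value theorem turns it back into a root. *)
Lemma root_near (S : set 'cV[R]_n) a t e : S a -> t \in xi a -> 0 < e ->
  \forall b \near mnear S a, exists2 y, y \in xi b & `|t - y| < e.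
Proof.
move=> Sa /simple_root [q [qF rq dq]] e0.
have [d /andP[d0 de] hd] := sign_change rq dq e0.
have h : peval q (cns (t - d) b) * peval q (cns (t + d) b) @[b --> mnear S a] -->
         peval q (cns (t - d) a) * peval q (cns (t + d) a).
  by apply: cvgM; [exact: (@scont_cns S q (t - d) a Sa) | exact: (@scont_cns S q (t + d) a Sa)].
rewrite -!horner_ppoly in h.
apply: filterS (cvgr_lt _ h _ hd) => b; rewrite -!horner_ppoly => hb.
have [|y] := poly_ivtoo _ hb; first by lra.
rewrite in_itv /= => /andP[y1 y2] ry.
exists y; last by rewrite ltr_norml; lra.
apply/mem_xi; exists q; split=> //; apply/poly_neq0P; exists (t - d) => h0.
by rewrite h0 mul0r ltxx in hb.
Qed.

Lemma sorted_gap (s : seq R) : sorted <%R s -> exists2 g, 0 < g &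
  forall i j, (i < j < size s)%N -> nth 0 s i + g <= nth 0 s j - g.
Proof.
elim: s => [|a s IH] /= pas; first by exists 1 => // i j; rewrite ltn0 andbF.
have [g g0 hg] := IH (path_sorted pas).
have ha : all (> a) s by apply: order_path_min pas; exact: lt_trans.
case: s pas IH hg ha => [|b s] /= pas _ hg ha.
  by exists 1 => // i [|j] /andP[].
have /andP[ab ha'] := ha.
have hb : all (> b) s.
  by case/andP: pas => _; apply: order_path_min; exact: lt_trans.
have bs : forall j, (j < (size s).+1)%N -> b <= nth 0 (b :: s) j.
  by move=> [|j] ltj //=; apply: ltW; apply: (allP hb); rewrite mem_nth.
exists (Num.min g ((b - a) / 2)); first by rewrite lt_min g0 /=; lra.
have m1 : Num.min g ((b - a) / 2) <= g by rewrite ge_min lexx.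
have m2 : Num.min g ((b - a) / 2) <= (b - a) / 2 by rewrite ge_min lexx orbT.
move=> [|i] [|j] //=; rewrite !ltnS => lt.
  have := bs j lt; move: (Num.min _ _) m1 m2 => m; lra.
have := hg i j lt; move: (Num.min _ _) m1 m2 => m; rewrite /=; lra.
Qed.

(* Every element of xi a is a simple root of some member of F, hence persists under
   perturbation; as the number of roots is constant on D, nothing else can appear. *)
Lemma scont_xi (D : set 'cV[R]_n) l j : (forall x, D x -> size (xi x) = l) -> (j < l)%N ->
  scont D (fun x => nth 0 (xi x) j).
Proof.
move=> Dl ltj a Da; apply/cvgrPdist_lt => e e0.
have [g g0 hg] := sorted_gap (sorted_xi a).
pose r := Num.min e g; have r0 : 0 < r by rewrite lt_min e0.
have re : r <= e by rewrite ge_min lexx.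
have rg : r <= g by rewrite ge_min lexx orbT.
have near_roots : \forall b \near mnear D a, D b /\
    forall i : 'I_l, exists2 y, y \in xi b & `|nth 0 (xi a) i - y| < r.
  apply: filterI; first exact: mnear_in.
  apply: (@filter_forall _ 'I_l
    (fun i b => exists2 y, y \in xi b & `|nth 0 (xi a) i - y| < r) (mnear D a) _) => i.
  by apply: root_near => //; rewrite mem_nth ?Dl.
apply: filterS near_roots => b [Db hb].
have /choice [y hy] : forall i : 'I_l, exists y, y \in xi b /\ `|nth 0 (xi a) i - y| < r.
  by move=> i; have [z h1 h2] := hb i; exists z.
pose ys := [seq y i | i <- enum 'I_l].
have sy : size ys = l by rewrite size_map size_enum_ord.
have nthy (i : 'I_l) : nth 0 ys i = y i.
  by rewrite (nth_map i) ?size_enum_ord ?nth_ord_enum.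
have ss : sorted <%R ys.
  apply/(sortedP 0) => i lti; rewrite sy in lti.
  rewrite (nthy (Ordinal (ltnW lti))) (nthy (Ordinal lti)).
  have [_] := hy (Ordinal (ltnW lti)); have [_] := hy (Ordinal lti).
  rewrite !ltr_norml /= => /andP[h1 h2] /andP[h3 h4].
  have := hg i i.+1; rewrite leqnn Dl // => /(_ lti); lra.
have E : xi b = ys.
  apply: lt_sorted_eq; [exact: sorted_xi | exact: ss |].
  have [||_ h] := uniq_min_size (lt_sorted_uniq ss) (s2 := xi b); last by move=> z; rewrite h.
    by move=> z /mapP [i _ ->]; case: (hy i).
  by rewrite sy Dl.
rewrite E (nthy (Ordinal ltj)); case: (hy (Ordinal ltj)) => _ h.
exact: lt_le_trans re.
Qed.

Local Notation c := (ext (@id 'cV[R]_n)).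

Lemma polyf_cns X k (d : X -> 'cV[R]_k) (ft : X -> R) (fx : X -> 'cV[R]_n) p :
  polyf d ft -> (forall i, polyf d (fun u => fx u i 0)) ->
  polyf d (fun u => peval p (cns (ft u) (fx u))).
Proof.
move=> hft hfx; apply: polyf_peval => i j.
rewrite ord1; case: (split_ordP i) => k' ->.
  by under eq_fun do rewrite col_mxEu ord1 mxE eqxx mulr1n.
by under eq_fun do rewrite col_mxEd.
Qed.

Lemma sdef_mem_xi : sdef c (fun u => u.2 \in xi u.1).
Proof.
pose P p (u : 'cV[R]_n * R) :=
  (exists s, peval p (cns s u.1) <> 0) /\ peval p (cns u.2 u.1) = 0.
have hP p : sdef c (P p).
  apply: sdef_and.
    apply: (sdef_ex (P := fun w => peval p (cns w.2 w.1.1) <> 0)); apply: sdef_not.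
    apply: sdef_eq; last exact: polyf_cst.
    apply: polyf_cns; first exact: polyf_snd.
    by move=> i; exact: (polyf_fst (polyf_fst (polyf_coord id i))).
  apply: sdef_eq; last exact: polyf_cst.
  apply: polyf_cns; first exact: polyf_snd.
  by move=> i; apply: (polyf_fst (polyf_coord id i)).
have : sdef c (fun u => exists p, List.In p F /\ P p u).
  elim: (F) => [|p F' IH].
    by apply: (eq_sdef _ (sdef_cst _ False)) => u; split=> // -[p []].
  apply: (eq_sdef _ (sdef_or (hP p) IH)) => u; split.
    by case=> [Pp|[q [qF Pq]]]; [exists p; split=> //; left | exists q; split=> //; right].
  by case=> q [[<-|qF] Pq]; [left | right; exists q].
apply: eq_sdef => -[x t] /=; rewrite mem_xi; split=> -[p].
  case=> pF [[s ps] pt]; exists p; split=> //; last by rewrite /root horner_ppoly pt.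
  by apply/poly_neq0P; exists s; rewrite horner_ppoly.
case=> pF /poly_neq0P [s]; rewrite horner_ppoly => ps /eqP; rewrite horner_ppoly => pt.
by exists p; split=> //; split=> //; exists s.
Qed.

Lemma sdef_rank j : sdef c (fun u => (j <= rank (xi u.1) u.2)%N).
Proof.
elim: j => [|j IH]; first by apply: (eq_sdef _ (sdef_cst _ True)) => u.
pose P (w : 'cV[R]_n * R * R) :=
  (w.2 \in xi w.1.1 /\ w.2 < w.1.2) /\ (j <= rank (xi w.1.1) w.2)%N.
have hf i : polyf (ext c) (fun w => c (w.1.1, w.2) i 0).
  case: (split_ordP i) => k ->.
    rewrite (_ : k = ord0); last by rewrite (ord1 k).
    rewrite [X in polyf _ X](_ : _ = snd); first exact: polyf_snd.
    by apply/funext => w; exact: ext_inr.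
  rewrite [X in polyf _ X](_ : _ = (fun w : 'cV[R]_n * R * R => w.1.1 k 0)).
    exact: (polyf_fst (polyf_fst (polyf_coord id k))).
  by apply/funext => w; exact: ext_inl.
have : sdef (ext c) P.
  apply: sdef_and; first apply: sdef_and.
  - exact: (sdef_comp hf sdef_mem_xi).
  - by apply: sdef_lt; [exact: polyf_snd | exact: (polyf_fst (polyf_snd _))].
  - exact: (sdef_comp hf IH).
move/sdef_ex; apply: eq_sdef => -[x t]; rewrite (rankS _ _ (sorted_xi x)).
by split=> -[r [h1 h2]]; exists r.
Qed.

Lemma sdef_rank_eq j : sdef c (fun u => rank (xi u.1) u.2 = j).
Proof.
apply: (eq_sdef _ (sdef_and (sdef_rank j) (sdef_not (sdef_rank j.+1)))) => u.
split=> [[h1 /negP h2]|->]; last by split=> //; rewrite ltnn.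
by apply/eqP; rewrite eqn_leq h1 leqNgt h2.
Qed.

Lemma semialg_size_xi l : semialg [set x | size (xi x) = l].
Proof.
have h j : sdef id (fun x => (j < size (xi x))%N).
  have := sdef_ex (sdef_and sdef_mem_xi (sdef_rank j)); apply: eq_sdef => x /=.
  by rewrite (size_gt_rank _ (sorted_xi x)); split=> [[r []]|[r]]; exists r.
apply: semialgP; case: l => [|l].
  by apply: (eq_sdef _ (sdef_not (h 0%N))) => x /=; split=> [/negP|->//]; lia.
by apply: (eq_sdef _ (sdef_and (h l) (sdef_not (h l.+1)))) => x /=; split=> [[? /negP]|->]; lia.
Qed.

(** Points outside [xi x] of equal rank have no root of p between them, unless p vanishes on the
    whole fibre; points of [xi x] of equal rank coincide. *)
Lemma sign_constant x t t' p : List.In p F ->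
  rank (xi x) t = rank (xi x) t' -> (t \in xi x) = (t' \in xi x) ->
  (0 <= peval p (cns t x)) = (0 <= peval p (cns t' x)).
Proof.
move=> pF Er Em; rewrite -!horner_ppoly.
wlog lett' : t t' Er Em / t <= t'.
  by move=> W; case: (leP t t') => [|/ltW] h; [exact: W | rewrite (W t' t)].
case: (boolP (t \in xi x)) => ht.
  by rewrite (rank_inj (sorted_xi x) ht _ Er) // -Em.
have [->|p0] := eqVneq (ppoly p x) 0; first by rewrite !horner0.
have nr : {in `[t, t'], forall r, ~~ root (ppoly p x) r}.
  move=> r; rewrite in_itv /= => /andP[h1 h2]; apply/negP => rr.
  have rx : r \in xi x by apply/mem_xi; exists p.
  have := rank_gap (sorted_xi x) Er ht rx; rewrite h1 /= -leNgt => h3.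
  have E : r = t' by apply/eqP; rewrite eq_le h2.
  by rewrite Em -E rx in ht.
have := polyrN0_itv nr (x := t) (y := t'); rewrite !in_itv /= !lexx lett'.
by move=> /(_ isT isT) E; rewrite -sgr_ge0 -E sgr_ge0.
Qed.

End Family.

Lemma semialg_signs (S : set 'cV[R]_(1 + n)) : semialg S ->
  exists Ps : seq (pexpr R (1 + n) 1), forall z w,
    (forall p, List.In p Ps -> (0 <= peval p z) = (0 <= peval p w)) -> S z <-> S w.
Proof.
elim=> [p|S1 S2 _ [P1 h1] _ [P2 h2]|S1 S2 _ [P1 h1] _ [P2 h2]|S1 _ [P1 h1]].
- by exists [:: p] => z w h /=; rewrite (h p) //; left.
- exists (P1 ++ P2) => z w h; rewrite /setU /= (h1 z w) ?(h2 z w) // => p hp;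
    apply: h; apply/in_cat_list; by [left | right].
- exists (P1 ++ P2) => z w h; rewrite /setI /= (h1 z w) ?(h2 z w) // => p hp;
    apply: h; apply/in_cat_list; by [left | right].
- by exists P1 => z w h; rewrite /setC /= (h1 z w).
Qed.

End Fibers.

(** * A homeomorphism of the line with (-1, 1), and the intervals between roots *)

Section Shrink.
Variable R : realType.
Implicit Types s t u : R.

Definition shrink t := t / (1 + `|t|).
Definition unshrink u := u / (1 - `|u|).

Lemma shrink_den t : 0 < 1 + `|t|.
Proof. by rewrite ltr_pwDl. Qed.

Lemma lt_shrink : {mono shrink : s t / s < t}.
Proof.
have lt s t : s < t -> shrink s < shrink t.
  move=> st; rewrite /shrink ltr_pdivrMr ?shrink_den // mulrAC ltr_pdivlMr ?shrink_den //.
  by case: (ger0P s) => s0; case: (ger0P t) => t0; nra.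
move=> s t; case: (ltgtP s t) => [/lt //|/lt ts|->]; last by rewrite ltxx.
by apply/negbTE; rewrite -leNgt ltW.
Qed.

Lemma shrink_itv t : -1 < shrink t < 1.
Proof.
rewrite -ltr_norml /shrink normrM normfV (gtr0_norm (shrink_den t)).
by rewrite ltr_pdivrMr ?shrink_den // mul1r ltrDr.
Qed.

Lemma shrinkK : cancel shrink unshrink.
Proof.
move=> t; rewrite /unshrink /shrink normrM normfV (gtr0_norm (shrink_den t)).
have d0 := shrink_den t; have h : 1 + `|t| != 0 by rewrite gt_eqF.
by field; rewrite h addrK oner_neq0.
Qed.

Lemma unshrinkK u : -1 < u < 1 -> shrink (unshrink u) = u.
Proof.
rewrite -ltr_norml => u1; have d0 : 0 < 1 - `|u| by rewrite subr_gt0.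
rewrite /shrink /unshrink normrM normfV (gtr0_norm d0).
have h : 1 - `|u| != 0 by rewrite gt_eqF.
by field; rewrite h subrK oner_neq0.
Qed.

Lemma scont_shrink m n (S : set 'M[R]_(m, n)) f : scont S f -> scont S (fun a => shrink (f a)).
Proof.
move=> hf; apply: scontM => //; apply: scontV; first by move=> a _; rewrite gt_eqF ?shrink_den.
by apply: scontD; [exact: scont_cst | exact: scont_norm].
Qed.

Lemma scont_unshrink m n (S : set 'M[R]_(m, n)) f : (forall a, S a -> -1 < f a < 1) ->
  scont S f -> scont S (fun a => unshrink (f a)).
Proof.
move=> f1 hf; apply: scontM => //; apply: scontV.
  by move=> a /f1; rewrite -ltr_norml => ?; rewrite gt_eqF // subr_gt0.
by apply: scontB; [exact: scont_cst | exact: scont_norm].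
Qed.

(* In the coordinate [shrink t] the unbounded intervals of the complement of s also
   have endpoints, namely -1 and 1. *)
Definition lower (s : seq R) r := if r is r'.+1 then shrink (nth 0 s r') else -1.
Definition upper (s : seq R) r := if (r < size s)%N then shrink (nth 0 s r) else 1.

Lemma rank_mem (s : seq R) t r : sorted <%R s -> (r < size s)%N ->
  (rank s t = r /\ (t \in s) = true) <-> t = nth 0 s r.
Proof.
move=> ss lt_r; split=> [[E ts]|->]; last by rewrite rank_nth // mem_nth.
by rewrite -E -{1}(nth_index 0 ts) -{2}(nth_index 0 ts) rank_nth ?index_mem ?nth_index.
Qed.

Lemma rank_notin (s : seq R) t r : sorted <%R s -> (r <= size s)%N ->
  (rank s t = r /\ (t \in s) = false) <-> lower s r < shrink t < upper s r.
Proof.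
move=> ss le_r; split=> [[E ts]|/andP[hlo hhi]].
  apply/andP; split.
    case: r E le_r => [|r] E le_r /=; first by case/andP: (shrink_itv t).
    by rewrite lt_shrink nth_lt_rank // E.
  rewrite /upper; case: ifP => lt_r; last by case/andP: (shrink_itv t).
  rewrite lt_shrink lt_neqAle leNgt nth_lt_rank // E ltnn andbT.
  by apply: contraFneq ts => ->; rewrite mem_nth.
have Er : rank s t = r.
  apply/eqP; rewrite eqn_leq; apply/andP; split.
    move: hhi; rewrite /upper; case: ifP => [lt_r|/negbT].
      by rewrite lt_shrink => h; rewrite leqNgt -nth_lt_rank // -leNgt ltW.
    by rewrite -leqNgt => h _; apply: leq_trans h; exact: rank_le_size.
  by case: r le_r hlo {hhi} => // r lt_r /=; rewrite lt_shrink nth_lt_rank.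
split=> //; apply/negbTE/negP => ts.
have lt_r : (r < size s)%N by rewrite -Er -(nth_index 0 ts) rank_nth ?index_mem.
have E := (rank_mem t ss lt_r).1 (conj Er ts).
by move: hhi; rewrite /upper lt_r -E ltxx.
Qed.

Lemma lower_upper (s : seq R) r : sorted <%R s -> (r <= size s)%N ->
  [/\ -1 <= lower s r, upper s r <= 1 & lower s r < upper s r].
Proof.
move=> ss le_r; split.
- by case: r {le_r} => [|r] //=; case/andP: (shrink_itv (nth 0 s r)) => /ltW.
- by rewrite /upper; case: ifP => // _; case/andP: (shrink_itv (nth 0 s r)) => _ /ltW.
- rewrite /upper; case: r le_r => [|r] le_r /=.
    by case: ifP => _; [case/andP: (shrink_itv (nth 0 s 0)) | lra].
  case: ifP => h; last by case/andP: (shrink_itv (nth 0 s r)).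
  by rewrite lt_shrink lt_sorted_ltn_nth // inE.
Qed.

End Shrink.

(** * Graphs and bands over a base cell *)

Section Cylinders.
Variables (R : realType) (n : nat).
Local Notation cns t x := (col_mx (t%:M : 'M[R]_1) x : 'cV[R]_(1 + n)).
Implicit Types (z : 'cV[R]_(1 + n)) (D : set 'cV[R]_n).

Definition hd z : R := z (lshift n ord0) 0.
Definition tl z : 'cV[R]_n := dsubmx z.

Lemma hd_cns t x : hd (cns t x) = t.
Proof. by rewrite /hd col_mxEu mxE eqxx. Qed.

Lemma tl_cns t x : tl (cns t x) = x.
Proof. exact: col_mxKd. Qed.

Lemma cns_hd_tl z : cns (hd z) (tl z) = z.
Proof.
rewrite -[RHS]vsubmxK /tl; congr col_mx; rewrite [RHS]mx11_scalar.
by congr (_%:M); rewrite mxE; congr (z _ _); apply: val_inj.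
Qed.

Lemma scont_hd S : scont S hd.
Proof. exact: scont_coord. Qed.

Lemma scont_tl S i j : scont S (fun z => tl z i j).
Proof. by rewrite /tl; under eq_fun do rewrite mxE; exact: scont_coord. Qed.

Lemma scont_tl_comp D f : scont D f -> scont [set z | D (tl z)] (fun z => f (tl z)).
Proof. by apply: (scont_comp (f := tl)) => // i j; exact: scont_tl. Qed.

Lemma scont_cns_comp m p (S : set 'M[R]_(m, p)) ft (fx : _ -> 'cV[R]_n) :
  scont S ft -> (forall i j, scont S (fun a => fx a i j)) ->
  forall i j, scont S (fun a => cns (ft a) (fx a) i j).
Proof.
move=> hft hfx i j; rewrite (ord1 j); case: (split_ordP i) => k ->.
  by rewrite (ord1 k); under eq_fun do rewrite col_mxEu mxE eqxx mulr1n.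
by under eq_fun do rewrite col_mxEd; exact: hfx.
Qed.

Lemma homeo_graph D k s : homeo_cube D k -> scont D s ->
  homeo_cube [set z | D (tl z) /\ hd z = s (tl z)] k.
Proof.
move=> [f [g [fD gD gf fg [/cont_onP cf /cont_onP cg]]]] cs.
exists (fun z => f (tl z)), (fun y => cns (s (g y)) (g y)); split.
- by move=> z [Dz _]; exact: fD.
- by move=> y hy; rewrite /= tl_cns hd_cns; split=> //; exact: gD.
- by move=> z [Dz hz]; rewrite gf // -hz cns_hd_tl.
- by move=> y hy; rewrite tl_cns fg.
split; apply/cont_onP => i j.
  by apply: scont_sub (scont_tl_comp (cf i j)) => z [].
apply: scont_cns_comp => //.
exact: (scont_comp gD).
Qed.

(** Over each base point the band is an interval in the coordinate [shrink], taken to (0, 1) by an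
    affine map whose coefficients depend continuously on the base point. *)
Lemma homeo_band D k lo hi : homeo_cube D k -> scont D lo -> scont D hi ->
  (forall x, D x -> [/\ -1 <= lo x, hi x <= 1 & lo x < hi x]) ->
  homeo_cube [set z | D (tl z) /\ lo (tl z) < shrink (hd z) < hi (tl z)] (1 + k).
Proof.
move=> [f [g [fD gD gf fg [/cont_onP cf /cont_onP cg]]]] clo chi lohi.
pose h (y : 'rV[R]_(1 + k)) : R := y 0 (lshift k ord0).
pose u y := lo (g (rsubmx y)) + h y * (hi (g (rsubmx y)) - lo (g (rsubmx y))).
have cubeP y : cube y -> 0 < h y < 1 /\ cube (rsubmx y).
  by move=> hy; split=> [|i]; rewrite ?mxE; exact: hy.
have uP y : cube y -> lo (g (rsubmx y)) < u y < hi (g (rsubmx y)).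
  move=> /cubeP [/andP[h0 h1] /gD /lohi [_ _ h2]]; rewrite /u; apply/andP; split; nra.
have u1 y : cube y -> -1 < u y < 1.
  move=> hy; have /andP[h1 h2] := uP _ hy; have [_ /gD /lohi [h3 h4 _]] := cubeP _ hy; lra.
exists (fun z => row_mx ((shrink (hd z) - lo (tl z)) / (hi (tl z) - lo (tl z)))%:M (f (tl z))),
       (fun y => cns (unshrink (u y)) (g (rsubmx y))); split.
- move=> z [Dz /andP[h1 h2]] i; case: (split_ordP i) => j ->; last by rewrite row_mxEr; exact: fD.
  rewrite row_mxEl (ord1 j) mxE eqxx mulr1n; have [_ _ h3] := lohi _ Dz.
  by rewrite divr_gt0 ?subr_gt0 //= ltr_pdivrMr ?subr_gt0 // mul1r ltrD2r.
- move=> y hy; rewrite /= tl_cns hd_cns unshrinkK; last exact: u1.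
  by split; [case: (cubeP _ hy) => _; exact: gD | exact: uP].
- move=> z [Dz /andP[h1 h2]]; rewrite /u row_mxKr gf // /h row_mxEl mxE eqxx mulr1n.
  have [_ _ h3] := lohi _ Dz.
  by rewrite divfK ?gt_eqF ?subr_gt0 // addrC subrK shrinkK cns_hd_tl.
- move=> y hy; have [_ h2] := cubeP _ hy; rewrite tl_cns hd_cns fg // unshrinkK; last exact: u1.
  rewrite /u addrAC subrr add0r mulfK; last first.
    by have [_ _ h3] := lohi _ (gD _ h2); rewrite gt_eqF ?subr_gt0.
  rewrite -[RHS]hsubmxK; congr row_mx; rewrite [RHS]mx11_scalar.
  by congr (_%:M); rewrite mxE /h; congr (y _ _); apply: val_inj.
split; apply/cont_onP => i j.
  rewrite (ord1 i); have sub : [set z | D (tl z) /\ lo (tl z) < shrink (hd z) < hi (tl z)] `<=`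
     [set z | D (tl z)] by move=> z [].
  apply: (scont_sub sub); case: (split_ordP j) => l ->; last first.
    apply: eq_scont (scont_tl_comp (cf 0 l)) => z _.
    by rewrite row_mxEr.
  rewrite (ord1 l); apply: (@eq_scont _ _ _ _
    (fun z => (shrink (hd z) - lo (tl z)) / (hi (tl z) - lo (tl z)))) => [z _|].
    by rewrite row_mxEl mxE eqxx mulr1n.
  apply: scontM.
    by apply: scontB; [apply: scont_shrink; exact: scont_hd | exact: scont_tl_comp].
  apply: scontV; first by move=> z /lohi [_ _ h3]; rewrite gt_eqF ?subr_gt0.
  by apply: scontB; exact: scont_tl_comp.
have cr i' j' : scont (@cube R (1 + k)) (fun y => (rsubmx y : 'rV_k) i' j').
  by under eq_fun do rewrite mxE; exact: scont_coord.
have cubeR (y : 'rV[R]_(1 + k)) : cube y -> cube (rsubmx y : 'rV[R]_k) by move=> /cubeP [].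
have cgr i' j' : scont (@cube R (1 + k)) (fun y => g (rsubmx y) i' j').
  exact: (scont_comp cubeR cr (cg i' j')).
have gDr (y : 'rV[R]_(1 + k)) : cube y -> D (g (rsubmx y)) by move=> /cubeR; exact: gD.
have clo' := scont_comp gDr cgr clo; have chi' := scont_comp gDr cgr chi.
apply: scont_cns_comp => //; apply: scont_unshrink => //.
by apply: scontD => //; apply: scontM; [exact: scont_coord | exact: scontB].
Qed.

Lemma mnear_setT_tl z (P : set 'cV[R]_n) : mnear setT (tl z) P -> mnear setT z (fun w => P (tl w)).
Proof.
by move=> hP; apply: (@mnear_map R _ _ _ _ setT setT tl z) => // i j; exact: scont_tl.
Qed.

Lemma mnear_interior m p (D : set 'M[R]_(m, p)) a (P : set 'M[R]_(m, p)) :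
  mnear setT a D -> mnear D a P -> mnear setT a P.
Proof.
move=> [d d0 hd'] [e e0 he]; exists (Num.min d e); first by rewrite lt_min d0.
by move=> b _; rewrite lt_min => /andP[h1 h2]; apply: he => //; exact: hd'.
Qed.

Lemma band_interior D lo hi z : mnear setT (tl z) D -> scont D lo -> scont D hi ->
  lo (tl z) < shrink (hd z) < hi (tl z) ->
  mnear setT z [set z | D (tl z) /\ lo (tl z) < shrink (hd z) < hi (tl z)].
Proof.
move=> iD clo chi /andP[h1 h2].
have Dz : D (tl z) by apply: mnear_self iD.
apply: (@mnear_interior _ _ [set w | D (tl w)]); first exact: (mnear_setT_tl iD).
have cl : shrink (hd w) - lo (tl w) @[w --> mnear [set w | D (tl w)] z] --> shrink (hd z) - lo (tl z).
  by apply: cvgB; [apply: (scont_shrink (@scont_hd _)) | apply: (scont_tl_comp clo)].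
have cu : shrink (hd w) - hi (tl w) @[w --> mnear [set w | D (tl w)] z] --> shrink (hd z) - hi (tl z).
  by apply: cvgB; [apply: (scont_shrink (@scont_hd _)) | apply: (scont_tl_comp chi)].
rewrite -subr_gt0 in h1; rewrite -subr_lt0 in h2.
have H1 := cvgr_gt _ cl 0 h1; have H2 := cvgr_lt _ cu 0 h2.
have H3 := mnear_in [set w | D (tl w)] z.
near=> w; split; first by near: w.
rewrite -subr_gt0 -[X in _ && X]subr_lt0; apply/andP.
split; near: w; [exact: H1 | exact: H2].
Unshelve. all: by end_near. Qed.

End Cylinders.

(** * Existence of adapted cell decompositions, by induction on the dimension *)

Section CellDecomposition.
Variable R : realType.

(** The field [cell_interior] serves the upper bound on dimension: a set without interior contains
    no cell of full dimension. The field [cell_dense] serves the lower bound: a given base point can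
    be moved slightly into such a cell. *)
Record cell_decomposition n (I : finType) (C : I -> set 'cV[R]_n) (K : I -> nat) : Prop :=
  CellDecomposition {
    cell_semialg : forall i, semialg (C i);
    cell_homeo : forall i, homeo_cube (C i) (K i);
    cell_cover : forall x, exists i, C i x;
    cell_inj : forall i j x, C i x -> C j x -> i = j;
    cell_dim : forall i, (K i <= n)%N;
    cell_interior : forall i, K i = n -> exists x, mnear setT x (C i);
    cell_dense : forall x e, 0 < e ->
      exists i y, [/\ K i = n, mdist2 x y < e & mnear setT y (C i)] }.

(** Together with [cell_cover], this makes every [S j] a union of cells. *)
Definition adapted n (I J : finType) (C : I -> set 'cV[R]_n) (S : J -> set 'cV[R]_n) :=
  forall i j x y, C i x -> C i y -> S j x -> S j y.

Definition has_cell_decompositions n := forall (J : finType) (S : J -> set 'cV[R]_n),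
  (forall j, semialg (S j)) ->
  exists (I : finType) C K, @cell_decomposition n I C K /\ adapted C S.

Lemma in_flatten_list (J : finType) (T : Type) (P : J -> seq T) j p :
  List.In p (P j) -> List.In p (flatten [seq P j | j <- enum J]).
Proof.
have := mem_enum J j; elim: (enum J) => //= i s IH; rewrite inE => + pj.
move=> /orP[/eqP <-|/IH h]; apply/in_cat_list; [by left | right; exact: h].
Qed.

Section Step.
Variable n : nat.
Hypothesis IHn : has_cell_decompositions n.
Local Notation cns t x := (col_mx (t%:M : 'M[R]_1) x : 'cV[R]_(1 + n)).

(** The base is decomposed along the number of roots and along the projections of the parts of [S j]
    at a given position among the roots. A position met by [S j] over one point of a cell is then
    met over all its points, and constancy of signs puts every point at that position in [S j]. *)
Lemma base_decomposition (J : finType) (S : J -> set 'cV[R]_(1 + n)) :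
  (forall j, semialg (S j)) ->
  exists F, deriv_closed F /\ exists (I : finType) C K, [/\ @cell_decomposition n I C K,
    forall i x y, C i x -> C i y -> size (xi F x) = size (xi F y) &
    forall i j x y t u, C i x -> C i y -> rank (xi F x) t = rank (xi F y) u ->
      (t \in xi F x) = (u \in xi F y) -> S j (cns t x) -> S j (cns u y)].
Proof.
move=> hS; have /choice [P hP] := fun j => semialg_signs (hS j).
have [F cF PF] := deriv_closure (flatten [seq P j | j <- enum J]).
exists F; split=> //; pose B := (\sum_(p <- F) pdeg p)%N.
pose S' (u : 'I_B.+1 + (J * 'I_B.+1 * bool)) : set 'cV[R]_n :=
  match u with
  | inl l => [set x | size (xi F x) = l]
  | inr (j, r, b) => [set x | exists t, (rank (xi F x) t = r /\ (t \in xi F x) = b) /\ S j (cns t x)]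
  end.
have hS' u : semialg (S' u).
  case: u => [l|[[j r] b]] /=; first exact: semialg_size_xi.
  apply: semialgP; apply: (sdef_ex (P := fun u => (rank (xi F u.1) u.2 = r /\
     (u.2 \in xi F u.1) = b) /\ S j (cns u.2 u.1))).
  apply: sdef_and; first apply: sdef_and; first exact: sdef_rank_eq.
    have h := sdef_mem_xi F; case: b; first exact: h.
    by apply: (eq_sdef _ (sdef_not h)) => u; split=> [/negP/negbTE|->].
  by exists (S j).
have [I [C [K [cad ad]]]] := IHn hS'.
exists I, C, K; split=> // [i x y Cx Cy|i j x y t u Cx Cy Er Em Sx].
  pose l : 'I_B.+1 := inord (size (xi F x)).
  have lE : l = size (xi F x) :> nat by rewrite inordK // ltnS size_xi.
  by have /= := ad i (inl l) x y Cx Cy; rewrite lE => ->.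
pose r : 'I_B.+1 := inord (rank (xi F x) t).
have rE : r = rank (xi F x) t :> nat.
  by rewrite inordK // ltnS (leq_trans (rank_le_size _ _)) ?size_xi.
have [|v [[rv mv] Sv]] := ad i (inr (j, r, t \in xi F x)) x y Cx Cy.
  by exists t; rewrite rE.
apply/(hP j _ _ _).1: Sv => p pj; apply: (sign_constant (F := F)).
- by apply: PF; exact: in_flatten_list pj.
- by rewrite rv rE.
- by rewrite mv Em.
Qed.

Lemma scont_lower F (D : set 'cV[R]_n) l r : deriv_closed F ->
  (forall x, D x -> size (xi F x) = l) -> (r <= l)%N -> scont D (fun x => lower (xi F x) r).
Proof.
move=> cF Dl; case: r => [|r] le_r; first exact: scont_cst.
by apply: scont_shrink; exact: (scont_xi cF Dl le_r).
Qed.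

Lemma scont_upper F (D : set 'cV[R]_n) l r : deriv_closed F ->
  (forall x, D x -> size (xi F x) = l) -> scont D (fun x => upper (xi F x) r).
Proof.
move=> cF Dl; apply: (@eq_scont _ _ _ _
  (fun x => if (r < l)%N then shrink (nth 0 (xi F x) r) else 1)) => [x Dx|].
  by rewrite /upper Dl.
case: (ltnP r l) => lt_r; last exact: scont_cst.
by apply: scont_shrink; exact: (scont_xi cF Dl lt_r).
Qed.

(** The section keeps the position of t among the roots: it is a root function, or the midpoint of a
    band in the coordinate [shrink]. *)
Lemma cylinder_section (J : finType) (S : J -> set 'cV[R]_(1 + n)) :
  (forall j, semialg (S j)) -> exists (I : finType) C K, @cell_decomposition n I C K /\
    forall i j x t, C i x -> S j (cns t x) ->
      exists2 s, scont (C i) s & forall y, C i y -> S j (cns (s y) y).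
Proof.
move=> hS; have [F [cF [I [C [K [cad sz ad]]]]]] := base_decomposition hS.
exists I, C, K; split=> // i j x t Cx Sx.
pose r := rank (xi F x) t; pose l := size (xi F x).
have Cl y : C i y -> size (xi F y) = l by move=> Cy; exact: sz Cy Cx.
case: (boolP (t \in xi F x)) => tx.
  have lt_r : (r < l)%N by rewrite /r -(nth_index 0 tx) rank_nth ?index_mem ?sorted_xi.
  exists (fun y => nth 0 (xi F y) r); first exact: (scont_xi cF Cl lt_r).
  move=> y Cy; apply: (ad i j x y t _ Cx Cy _ _ Sx).
    by rewrite rank_nth ?sorted_xi ?Cl.
  by rewrite tx mem_nth ?Cl.
have le_r : (r <= l)%N by exact: rank_le_size.
pose lo y := lower (xi F y) r; pose hi y := upper (xi F y) r.
have lohi y : C i y -> [/\ -1 <= lo y, hi y <= 1 & lo y < hi y].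
  by move=> Cy; apply: lower_upper; rewrite ?sorted_xi ?Cl.
exists (fun y => unshrink ((lo y + hi y) / 2)).
  apply: scont_unshrink; first by move=> y /lohi [h1 h2 h3]; lra.
  apply: scontM; last exact: scont_cst.
  by apply: scontD; [exact: (scont_lower cF Cl le_r) | exact: (@scont_upper F (C i) l r cF Cl)].
move=> y Cy; have [h1 h2 h3] := lohi y Cy.
have [Er Em] : rank (xi F y) (unshrink ((lo y + hi y) / 2)) = r /\
    (unshrink ((lo y + hi y) / 2) \in xi F y) = false.
  apply/rank_notin; rewrite ?sorted_xi ?Cl // unshrinkK; last by lra.
  by rewrite -/(lo y) -/(hi y); lra.
by apply: (ad i j x y t _ Cx Cy _ _ Sx); rewrite ?Er ?Em // (negPf tx).
Qed.

Lemma cell_decompositionS : has_cell_decompositions (1 + n).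
Proof.
move=> J S hS; have [F [cF [I [C [K [cad sz ad]]]]]] := base_decomposition hS.
pose B := (\sum_(p <- F) pdeg p)%N.
(* The cell (i, r, b) consists of the points over C i whose fibre coordinate has
   exactly r roots below it and is itself a root iff b. *)
pose D (u : I * 'I_B.+1 * bool) : set 'cV[R]_(1 + n) := [set z | C u.1.1 (tl z) /\
  (rank (xi F (tl z)) (hd z) = u.1.2 /\ (hd z \in xi F (tl z)) = u.2)].
(* Empty cells are discarded, since cubes are nonempty; a point of the cell also bounds its index r
   by the number of roots. *)
pose I' := {u : I * 'I_B.+1 * bool | `[< exists z, D u z >]}.
pose C' (u : I') := D (val u); pose K' (u : I') := ((~~ (val u).2) + K (val u).1.1)%N.
have DP (i : I) z : C i (tl z) -> exists2 u : I', C' u z & (val u).1.1 = i /\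
    (val u).2 = (hd z \in xi F (tl z)).
  move=> Cz; pose r : 'I_B.+1 := inord (rank (xi F (tl z)) (hd z)).
  have rE : r = rank (xi F (tl z)) (hd z) :> nat.
    by rewrite inordK // ltnS (leq_trans (rank_le_size _ _)) ?size_xi.
  pose v := (i, r, hd z \in xi F (tl z)).
  have Dv : D v z by split=> //=; rewrite rE.
  have v1 : `[< exists z, D v z >] by apply/asboolP; exists z.
  by exists (Sub v v1); rewrite /C' !SubK.
have cellE (u : I') (i := (val u).1.1) (r := (val u).1.2) :
    if (val u).2 then exists2 s, scont (C i) s & C' u = [set z | C i (tl z) /\ hd z = s (tl z)]
    else exists lo hi, [/\ scont (C i) lo, scont (C i) hi,
      forall x, C i x -> [/\ -1 <= lo x, hi x <= 1 & lo x < hi x] &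
      C' u = [set z | C i (tl z) /\ lo (tl z) < shrink (hd z) < hi (tl z)]].
  have /asboolP [z0 [Cz0 [Er Em]]] := valP u; rewrite -/i -/r in Cz0 Er.
  set l := size (xi F (tl z0)).
  have Cl y : C i y -> size (xi F y) = l by move=> Cy; exact: sz Cy Cz0.
  have le_r : (r <= l)%N by rewrite -Er; exact: rank_le_size.
  case E : ((val u).2).
    rewrite E in Em; have lt_r : (r < l)%N.
      by rewrite -Er -(nth_index 0 Em) rank_nth ?index_mem ?sorted_xi.
    exists (fun y => nth 0 (xi F y) r); first exact: (scont_xi cF Cl lt_r).
    apply/seteqP; split=> z [Cz h]; split=> //.
      by apply/rank_mem; rewrite ?sorted_xi ?Cl //; rewrite E in h.
    by rewrite E; apply/rank_mem; rewrite ?sorted_xi ?Cl.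
  exists (fun y => lower (xi F y) r), (fun y => upper (xi F y) r); split.
  - exact: (scont_lower cF Cl le_r).
  - exact: (@scont_upper F (C i) l r cF Cl).
  - by move=> y Cy; apply: lower_upper; rewrite ?sorted_xi ?Cl.
  - apply/seteqP; split=> z [Cz h]; split=> //.
      by apply/rank_notin; rewrite ?sorted_xi ?Cl //; rewrite E in h.
    by rewrite E; apply/rank_notin; rewrite ?sorted_xi ?Cl.
have int u z : (val u).2 = false -> C' u z -> mnear setT (tl z) (C (val u).1.1) ->
    mnear setT z (C' u).
  move=> Eu Cz iD; have := cellE u; rewrite Eu => -[lo [hi [clo chi _ E]]].
  by move: Cz; rewrite E => -[_ h]; exact: band_interior.
exists I', C', K'; split; first split.
- move=> u; apply: semialgP; apply: (eq_sdef (P := fun z => D (val u) z)) => //.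
  have cK i : polyf id (fun z : 'cV[R]_(1 + n) => ext id (tl z, hd z) i 0).
    by exists (PVar R i ord0) => z /=; rewrite /ext /= cns_hd_tl.
  apply: sdef_and.
    apply: (@sdef_semialg R _ _ id _ _ (C (val u).1.1) (@tl R n)); first exact: (cell_semialg cad).
    by move=> i j; exists (PVar R (rshift 1 i) ord0) => z /=; rewrite mxE (ord1 j).
  apply: sdef_and; first exact: (sdef_comp cK (sdef_rank_eq F _)).
  have h := sdef_comp cK (sdef_mem_xi F); case: ((val u).2); first exact: h.
  by apply: (eq_sdef _ (sdef_not h)) => z /=; split=> [/negP/negbTE|->].
- move=> u; have := cellE u; have hC := cell_homeo cad (val u).1.1; rewrite /K'.
  case: ((val u).2) => /= [[s cs ->]|[lo [hi [clo chi lohi ->]]]].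
    exact: homeo_graph.
  exact: homeo_band.
- move=> z; have [i Ci] := cell_cover cad (tl z).
  by have [u Cu _] := DP i z Ci; exists u.
- move=> u v z [Cu [ru mu]] [Cv [rv mv]]; apply: val_inj.
  have Ei := cell_inj cad Cu Cv; move: Ei ru rv mu mv.
  case: (val u) => -[iu ju] bu; case: (val v) => -[iv jv] bv /= -> ru rv <- <-.
  by congr (_, _, _); apply: val_inj => /=; rewrite -ru -rv.
- by move=> u; rewrite /K'; apply: leq_add; [case: (_.2) | exact: cell_dim cad _].
- move=> u; rewrite /K'; have := int u; have := cellE u; case: (val u).2 => /=.
    by move=> _ _; rewrite add0n => E; have := cell_dim cad (val u).1.1; rewrite E ltnn.
  move=> [lo [hi [clo chi lohi E]]] hint [] /(cell_interior cad) [x ix].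
  have Cx : C (val u).1.1 x by exact: mnear_self ix.
  have [h1 h2 h3] := lohi x Cx.
  exists (cns (unshrink ((lo x + hi x) / 2)) x); apply: hint; rewrite ?tl_cns //.
  by rewrite E /= tl_cns hd_cns; split=> //; rewrite unshrinkK; lra.
- move=> z e e0; have [d d0 hd'] : exists2 d, 0 < d & forall t x, `|t - hd z| < d ->
      mdist2 (tl z) x < d -> mdist2 z (cns t x) < e.
    have E t x : mdist2 z (cns t x) = (hd z - t) ^+ 2 + mdist2 (tl z) x.
      rewrite /mdist2 -{1}(cns_hd_tl z) big_split_ord /= big_ord1 big_ord1 !col_mxEu !mxE.
      rewrite !eqxx; congr (_ + _); apply: eq_bigr => i _; apply: eq_bigr => j _.
      by rewrite !col_mxEd.
    exists (Num.min 1 (e / 2)); first by rewrite lt_min ltr01 /=; lra.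
    move=> t x; rewrite E distrC !lt_min => /andP[h1 h2] /andP[_ h3].
    rewrite -real_normK ?num_real //; have := normr_ge0 (hd z - t).
    by move: `|_| h1 h2 => a h1 h2 a0; nra.
  have [i [x [Ki zx ix]]] := cell_dense cad (tl z) d0.
  have [t tz tx] : exists2 t, `|t - hd z| < d & t \notin xi F x.
    (* Among more points [f k] than there are roots, one is not a root; k + 2 in the denominator
       keeps its distance from [hd z] below d. *)
    pose f k := hd z + d / (k.+2)%:R.
    have fP k : `|f k - hd z| < d.
      rewrite /f addrAC subrr add0r gtr0_norm ?divr_gt0 // ltr_pdivrMr //.
      by rewrite -[X in X < _]mulr1 ltr_pM2l // ltr1n.
    have f_inj : injective f.
      move=> k k' /addrI /(mulfI (lt0r_neq0 d0)) /invr_inj /eqP.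
      by rewrite eqr_nat => /eqP [].
    apply: contrapT => hN; pose s := [seq f k | k <- iota 0 (size (xi F x)).+1].
    have : (size s <= size (xi F x))%N.
      apply: uniq_leq_size; first by rewrite map_inj_uniq ?iota_uniq.
      move=> _ /mapP [k _ ->]; apply/negPn/negP => h; apply: hN; by exists (f k).
    by rewrite size_map size_iota ltnn.
  have Cx : C i (tl (cns t x)) by rewrite tl_cns; exact: mnear_self ix.
  have [u Cu [ui ub]] := DP i _ Cx.
  rewrite tl_cns hd_cns (negPf tx) in ub.
  exists u, (cns t x); split; first by rewrite /K' ui ub Ki.
    exact: hd'.
  by apply: int => //; rewrite tl_cns ui.
move=> u j z w [Cz [rz mz]] [Cw [rw mw]] Sz.
rewrite -(cns_hd_tl w); apply: (ad _ j _ _ (hd z) _ Cz Cw); rewrite ?cns_hd_tl //.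
  by rewrite rz rw.
by rewrite mz mw.
Qed.

End Step.

Lemma cell_decomposition0 : has_cell_decompositions 0.
Proof.
move=> J S hS; exists unit, (fun=> setT), (fun=> 0%N).
have E (x y : 'cV[R]_0) : x = y by apply/colP => -[].
split; last by move=> i j x y _ _; rewrite (E x y).
split=> //.
- by move=> _; apply: semialgP; exact: sdef_cst.
- move=> _; exists (fun=> 0), (fun=> 0); split=> //.
  + by move=> a _ [].
  + by move=> y _; apply/rowP => -[].
  + split=> a _ e e0; exists 1 => // b _ _; by rewrite /mdist2 ?big_ord0 // big1 // => i _; rewrite big_ord0.
- by move=> [] [].
- by move=> _ _; exists 0; exists 1.
- move=> x e e0; exists tt, x; split=> //; last by exists 1.
  by rewrite /mdist2 big_ord0.
Qed.

Theorem cell_decompositionP n : has_cell_decompositions n.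
Proof.
elim: n => [|n IH]; [exact: cell_decomposition0 | exact: (cell_decompositionS IH)].
Qed.

End CellDecomposition.

(** * Semialgebraic subgroups of O(d) and max filtering *)

Section InnerProduct.
Variables (R : realType) (d : nat).
Implicit Types (x y z : 'cV[R]_d) (g : 'M[R]_d).

Lemma ipE x y : ip x y = (x^T *m y) 0 0.
Proof. by rewrite mxE; apply: eq_bigr => i _; rewrite mxE. Qed.

Lemma ipC x y : ip x y = ip y x.
Proof. by apply: eq_bigr => i _; rewrite mulrC. Qed.

Lemma ipDl x y z : ip (x + y) z = ip x z + ip y z.
Proof. by rewrite -big_split; apply: eq_bigr => i _; rewrite mxE mulrDl. Qed.

Lemma ipZl a x y : ip (a *: x) y = a * ip x y.
Proof. by rewrite /ip mulr_sumr; apply: eq_bigr => i _; rewrite mxE mulrA. Qed.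

Lemma ipBl x y z : ip (x - y) z = ip x z - ip y z.
Proof. by rewrite -scaleN1r ipDl ipZl mulN1r. Qed.

Lemma ipDr x y z : ip x (y + z) = ip x y + ip x z.
Proof. by rewrite ipC ipDl !(ipC x). Qed.

Lemma ipZr a x y : ip x (a *: y) = a * ip x y.
Proof. by rewrite ipC ipZl ipC. Qed.

Lemma ip_ge0 x : 0 <= ip x x.
Proof. by apply: sumr_ge0 => i _; rewrite -expr2 sqr_ge0. Qed.

Lemma ip_eq0 x : ip x x = 0 -> x = 0.
Proof.
move=> /eqP; rewrite psumr_eq0; last by move=> i _; rewrite -expr2 sqr_ge0.
move=> /allP h; apply/colP => i; rewrite mxE; apply/eqP.
by have := h i (mem_index_enum _); rewrite mulf_eq0 orbb.
Qed.

Lemma ip_subr x y : ip (x - y) (x - y) = ip x x + ip y y - 2 * ip x y.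
Proof. by rewrite -scaleN1r ipDl !ipDr !ipZl !ipZr (ipC y x); ring. Qed.

Lemma ip_mulmx g x y : ip (g *m x) y = ip x (g^T *m y).
Proof. by rewrite !ipE trmx_mul mulmxA. Qed.

Lemma ip_orthogonal g x y : Defs.orthogonal g -> ip (g *m x) (g *m y) = ip x y.
Proof. by move=> og; rewrite ip_mulmx mulmxA og mul1mx. Qed.

Lemma ip_le_max x y : ip x y <= (ip x x + ip y y) / 2.
Proof. by have := ip_ge0 (x - y); rewrite ip_subr; lra. Qed.

(** The hypotheses make the squared norm of y - x nonpositive. *)
Lemma ip_eq_of_ge x y : ip x x <= ip y y -> ip y y <= ip y x -> y = x.
Proof.
move=> h1 h2; apply/eqP; rewrite -subr_eq0; apply/eqP/ip_eq0.
by apply/eqP; rewrite eq_le ip_ge0 ip_subr andbT; lra.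
Qed.

Lemma sqr_coord_le_ip x i : x i 0 ^+ 2 <= ip x x.
Proof.
rewrite /ip (bigD1 i) //= -expr2 lerDl; apply: sumr_ge0 => j _.
by rewrite -expr2 sqr_ge0.
Qed.

Lemma orthogonal_entry g i j : Defs.orthogonal g -> -1 <= g i j <= 1.
Proof.
move=> og; rewrite -ler_norml -(ler_pXn2r (n := 2)) ?nnegrE // expr1n real_normK ?num_real //.
have := sqr_coord_le_ip (col j g) i; rewrite mxE => /le_trans; apply.
have : (g^T *m g) j j = 1 by rewrite og mxE eqxx.
by rewrite mxE => <-; apply: ler_sum => k _; rewrite !mxE.
Qed.

Lemma cauchy_schwarz x y : ip x y ^+ 2 <= ip x x * ip y y.
Proof.
have [->|y0] := eqVneq y 0.
  have ip0 (w : 'cV[R]_d) : ip w 0 = 0 by rewrite -(scale0r 0) ipZr mul0r.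
  by rewrite !ip0 expr0n mulr0.
have ny : 0 < ip y y.
  by rewrite lt_neqAle ip_ge0 andbT eq_sym; apply/eqP => /ip_eq0 /eqP; rewrite (negPf y0).
have := ip_ge0 (ip y y *: x - ip x y *: y).
rewrite ip_subr !ipZl !ipZr.
have -> : ip y y * (ip y y * ip x x) + ip x y * (ip x y * ip y y) -
  2 * (ip y y * (ip x y * ip x y)) = ip y y * (ip x x * ip y y - ip x y ^+ 2) by ring.
by rewrite pmulr_rge0 // subr_ge0.
Qed.

End InnerProduct.

Section MatrixContinuity.
Variable R : realType.

Lemma scont_mulmx m n p q r (S : set 'M[R]_(m, n)) (f : _ -> 'M[R]_(p, q)) (g : _ -> 'M[R]_(q, r)) :
  (forall i j, scont S (fun a => f a i j)) -> (forall i j, scont S (fun a => g a i j)) ->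
  forall i j, scont S (fun a => (f a *m g a) i j).
Proof.
move=> hf hg i j; apply: (@eq_scont _ _ _ _ (fun a => \sum_k f a i k * g a k j)).
  by move=> a _; rewrite mxE.
by apply: scont_sum => k; apply: scontM.
Qed.

Lemma scont_trmx m n p q (S : set 'M[R]_(m, n)) (f : _ -> 'M[R]_(p, q)) :
  (forall i j, scont S (fun a => f a i j)) -> forall i j, scont S (fun a => (f a)^T i j).
Proof. by move=> hf i j; apply: eq_scont (hf j i) => a _; rewrite mxE. Qed.

Lemma scont_ip m n d (S : set 'M[R]_(m, n)) (f g : _ -> 'cV[R]_d) :
  (forall i j, scont S (fun a => f a i j)) -> (forall i j, scont S (fun a => g a i j)) ->
  scont S (fun a => ip (f a) (g a)).
Proof. by move=> hf hg; apply: scont_sum => i; apply: scontM. Qed.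

End MatrixContinuity.

(** * Semialgebraic sets are locally trivial somewhere on every nonempty set *)

Section LocallyClosed.
Variables (R : realType) (m n : nat).

Definition mopen (U : set 'M[R]_(m, n)) := forall a, U a -> mnear setT a U.

(** The alternative is symmetric, which settles complements. The set X is arbitrary because unions
    and intersections use the second induction hypothesis on the part of X left by the first. *)
Lemma semialg_locally_trivial (S X : set 'M[R]_(m, n)) : semialg S -> X !=set0 ->
  exists U, [/\ mopen U, X `&` U !=set0 & (X `&` U `<=` S) \/ (X `&` U `<=` ~` S)].
Proof.
move=> hS; elim: hS X => [p|S1 S2 _ IH1 _ IH2|S1 S2 _ IH1 _ IH2|S1 _ IH1] X X0.
- case: (pselect (X `<=` [set A | 0 <= peval p A])) => [h|/existsNP [a /not_implyP [Xa pa]]].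
    exists setT; split=> //; [by move=> a _; exact: filterT | by rewrite setIT|].
    by left; rewrite setIT.
  exists [set b | peval p b < 0]; split.
  + by move=> b pb; exact: (cvgr_lt _ (@scont_peval _ _ _ setT p b Logic.I)).
  + by exists a; split=> //=; rewrite ltNge; apply/negP.
  + by right=> b [_ pb] /=; apply/negP; rewrite -ltNge.
- have [U [oU U0 hU]] := IH1 X X0; have [V [oV V0 hV]] := IH2 _ U0.
  have oUV : mopen (U `&` V) by move=> a [/oU ? /oV ?]; exact: filterI.
  exists (U `&` V); rewrite setIA; split=> //.
  case: hU hV => [hU _|hU [hV|hV]].
  + by left=> a [h _]; left; exact: hU.
  + by left=> a h; right; exact: hV.
  + by right=> a h [h1|h1]; [exact: (hU a h.1) | exact: (hV a h)].
- have [U [oU U0 hU]] := IH1 X X0; have [V [oV V0 hV]] := IH2 _ U0.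
  have oUV : mopen (U `&` V) by move=> a [/oU ? /oV ?]; exact: filterI.
  exists (U `&` V); rewrite setIA; split=> //.
  case: hU hV => [hU [hV|hV]|hU _].
  + by left=> a h; split; [exact: hU h.1 | exact: hV].
  + by right=> a h [_ h1]; exact: (hV a h).
  + by right=> a [h _] [h1 _]; exact: (hU a h).
- have [U [oU U0 hU]] := IH1 X X0; exists U; split=> //.
  by rewrite setCK; case: hU; [right | left].
Qed.

End LocallyClosed.

(** * Closedness of the group and attainment of the maximum *)

Section Group.
Variables (R : realType) (d : nat) (G : set 'M[R]_d).
Hypothesis GO : subgroup_Od G.
Hypothesis Gsa : semialg G.

Let Gorth g : G g -> Defs.orthogonal g. Proof. by case: GO => h _ _ _; exact: h. Qed.
Let G1 : G 1%:M. Proof. by case: GO. Qed.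
Let GM g h : G g -> G h -> G (g *m h). Proof. by case: GO => _ _ hM _; exact: hM. Qed.
Let GT g : G g -> G g^T. Proof. by case: GO => _ _ _; apply. Qed.

Definition adherent (A : 'M[R]_d) := forall P : set 'M[R]_d, mnear setT A P -> exists2 g, G g & P g.

Lemma adherent_orthogonal A : adherent A -> Defs.orthogonal A.
Proof.
move=> hA; apply/matrixP => i j; apply/eqP; rewrite -subr_eq0 -normr_le0.
apply/ler_addgt0Pl => e e0; rewrite addr0.
have c : scont setT (fun B : 'M[R]_d => (B^T *m B) i j).
  apply: scont_mulmx; last by move=> *; exact: scont_coord.
  by apply: scont_trmx => *; exact: scont_coord.
have [g Gg] := hA _ (cvgr_dist_lt _ _ (c A Logic.I) _ e0).
by rewrite (Gorth Gg) => /ltW.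
Qed.

Lemma adherent_mul g A : G g -> adherent A -> adherent (g *m A).
Proof.
move=> Gg hA P hP; have c : g *m x @[x --> mnear setT A] --> mnear setT (g *m A).
  apply: mnear_map => //; apply: scont_mulmx => *; [exact: scont_cst | exact: scont_coord].
by have [h Gh Ph] := hA _ (c _ hP); exists (g *m h) => //; exact: GM.
Qed.

(** Some relatively open part of the closure lies in G; the other alternative fails because G is
    dense in its closure. Let g0 in G belong to this part. For A in the closure and g in G close to
    A, the product of g0, g^T and A is in the closure and close to g0, hence in G, and so A is in
    G. *)
Lemma semialg_group_closed A : adherent A -> G A.
Proof.
move=> hA; have adG g : G g -> adherent g by move=> Gg P hP; exists g => //; exact: mnear_self hP.
have [|U [oU [a [ha Ua]] hU]] := semialg_locally_trivial (X := adherent) Gsa.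
  by exists A.
have [g0 Gg0 Ug0] := ha _ (oU a Ua).
have {}hU B : adherent B -> U B -> G B.
  by case: hU => hU hB UB; [exact: hU | case: (hU g0); first by split; [exact: adG|]].
have c : g0 *m x^T *m A @[x --> mnear setT A] --> mnear setT (g0 *m A^T *m A).
  apply: mnear_map => //; apply: scont_mulmx; last by move=> *; exact: scont_cst.
  apply: scont_mulmx; first by move=> *; exact: scont_cst.
  by apply: scont_trmx => *; exact: scont_coord.
rewrite -mulmxA (adherent_orthogonal hA) mulmx1 in c.
have [g Gg Ug] := hA _ (c _ (oU _ Ug0)).
have Gh : G (g0 *m g^T *m A) by apply: hU => //; apply: adherent_mul => //; apply: GM => //; exact: GT.
have := GM (GM Gg (GT Gg0)) Gh.
rewrite -mulmxA [g0^T *m _]mulmxA [g0^T *m _]mulmxA (Gorth Gg0) mul1mx mulmxA.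
by rewrite -{1}(trmxK g) (Gorth (GT Gg)) mul1mx.
Qed.

(** Near-maximizers have entries in [-1, 1]; a cluster point of them belongs to the closed group and
    attains the supremum. *)
Lemma orbit_max z x : exists2 g, G g & forall h, G h -> ip z (h *m x) <= ip z (g *m x).
Proof.
pose E : set R := [set ip z (h *m x) | h in G].
have E0 : E !=set0 by exists (ip z (1%:M *m x)); exists 1%:M.
have ubE : has_ubound E.
  exists ((ip z z + ip x x) / 2) => _ [h Gh <-].
  by rewrite -(ip_orthogonal x x (Gorth Gh)); exact: ip_le_max.
have supE : has_sup E by [].
have /choice [h hh] : forall k : nat, exists h, G h /\ sup E - k.+1%:R^-1 < ip z (h *m x).
  move=> k; have [|_ [h Gh <-] hk] := sup_adherent (eps := k.+1%:R^-1) _ supE.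
    by rewrite invr_gt0 ltr0n.
  by exists h.
have [k i|a _ cla] := @bolzano_weierstrass R (d * d) (fun k => mxvec (h k)) (-1) 1.
  case: (hh k) => /Gorth oh _; case: (mxvec_indexP i) => i' j'; rewrite mxvecE.
  exact: orthogonal_entry.
pose A : 'M[R]_d := vec_mx a.
have near_h P : mnear setT A P -> forall N, exists2 k, (N <= k)%N & P (h k).
  move=> /mnear_sup [e e0 hP] N; have [k Nk hk] := cla e e0 N.
  exists k => //; apply: hP => // i j; have := hk (mxvec_index i j).
  by rewrite mxvecE mxE.
have GA : G A.
  apply: semialg_group_closed => P /near_h /(_ 0%N) [k _ Pk]; exists (h k) => //.
  by case: (hh k).
exists A => // g Gg; apply: (@le_trans _ _ (sup E)).
  by apply: sup_upper_bound => //; exists g.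
apply/ler_addgt0Pl => e e0.
have c : scont setT (fun B : 'M[R]_d => ip z (B *m x)).
  apply: scont_ip; first by move=> *; exact: scont_cst.
  by apply: scont_mulmx => *; [exact: scont_coord | exact: scont_cst].
have e2 : 0 < e / 2 by lra.
have [k Nk hk] := near_h _ (cvgr_dist_lt _ _ (c A Logic.I) _ e2) (Num.bound (2 / e)).
have [_ h1] := hh k; move: hk; rewrite ltr_norml => /andP[h2 h3].
have h4 : k.+1%:R^-1 < e / 2.
  rewrite -[X in _ < X]invf_div ltf_pV2 ?posrE ?ltr0n // ?divr_gt0 //.
  apply: (lt_le_trans (archi_boundP _)); first by rewrite divr_ge0 // ltW.
  by rewrite ler_nat; apply: (leq_trans Nk).
have {}h1 : sup E - e / 2 < ip z (h k *m x) by apply: (lt_trans _ h1); rewrite ltrD2l ltrN2.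
lra.
Qed.

(** Moving the group element off z reduces the supremum over two orbits to one over the orbit of
    x. *)
Lemma maxfiltP z x : exists g, [/\ G g, maxfilt G z x = ip z (g *m x) &
  forall h, G h -> ip z (h *m x) <= maxfilt G z x].
Proof.
have [g Gg hg] := orbit_max z x; exists g.
suff -> : maxfilt G z x = ip z (g *m x) by [].
have mem h : G h -> [set r | exists p q, [/\ Defs.orbit G z p, Defs.orbit G x q & r = ip p q]] (ip z (h *m x)).
  move=> Gh; exists z, (h *m x); split=> //; last by exists h.
  by exists 1%:M => //; rewrite mul1mx.
have ub : ubound [set r | exists p q, [/\ Defs.orbit G z p, Defs.orbit G x q & r = ip p q]] (ip z (g *m x)).
  move=> _ [_ [_ [[k Gk <-] [l Gl <-] ->]]].
  by rewrite ip_mulmx mulmxA; apply: hg; apply: GM => //; exact: GT.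
apply/eqP; rewrite eq_le; apply/andP; split.
  by apply: sup_le_ub => //; eexists; exact: mem Gg.
by apply: sup_upper_bound; [split; [eexists; exact: mem Gg | eexists; exact: ub] | exact: mem].
Qed.

Lemma maxfilt_ge z x h : G h -> ip z (h *m x) <= maxfilt G z x.
Proof. by have [g [_ _]] := maxfiltP z x; apply. Qed.

Lemma orbit_eq x y g h : G g -> G h -> g *m x = h *m y -> Defs.orbit G x = Defs.orbit G y.
Proof.
have sub u v k l : G k -> G l -> k *m u = l *m v -> Defs.orbit G u `<=` Defs.orbit G v.
  move=> Gk Gl E _ [m Gm <-]; exists (m *m (k^T *m l)).
    by apply: GM => //; apply: GM => //; exact: GT.
  by rewrite -!mulmxA -E [k^T *m (k *m u)]mulmxA (Gorth Gk) mul1mx.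
by move=> Gg Gh E; apply/seteqP; split; [exact: (sub _ _ g h) | exact: (sub _ _ h g)].
Qed.

(* If the maxima agree near z and |x| <= |y|, move z towards a maximizer q of y:
   the increment forces q to be in the orbit of x. *)
Lemma maxfilt_eq_interior x y z :
  mnear setT z [set w | maxfilt G w x = maxfilt G w y] -> Defs.orbit G x = Defs.orbit G y.
Proof.
wlog le_xy : x y / ip x x <= ip y y.
  move=> W hz; case: (leP (ip x x) (ip y y)) => [h|/ltW h]; first exact: W.
  by apply/esym; apply: W => //; move: hz; congr mnear; apply/seteqP; split=> w /= ->.
move=> hz; have Ez := mnear_self (S := setT) Logic.I hz.
have [g [Gg yg _]] := maxfiltP z y; set q := g *m y in yg.
have [e e0 he] : exists2 e, 0 < e & maxfilt G (z + e *: q) x = maxfilt G (z + e *: q) y.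
  (* The number 1 + |q|^2 bounds every coordinate of q, so the step along q stays in the
     neighbourhood of z. *)
  have [e e0 he] := mnear_sup hz; pose N := 1 + ip q q.
  have N0 : 0 < N by rewrite ltr_pwDl ?ip_ge0.
  exists (e / (2 * N)); first by rewrite divr_gt0 ?mulr_gt0.
  apply: he => // i j.
  have Eq c : (z + c *: q) i 0 = z i 0 + c * q i 0 by rewrite [LHS]mxE [X in _ + X]mxE.
  rewrite (ord1 j) Eq opprD addNKr normrN normrM gtr0_norm ?divr_gt0 ?mulr_gt0 //.
  have qN : `|q i 0| <= N.
    have := sqr_coord_le_ip q i; rewrite -real_normK ?num_real // /N.
    by move: `|_| (normr_ge0 (q i 0)) => a a0 ha; nra.
  rewrite mulrAC ltr_pdivrMr ?mulr_gt0 // ltr_pM2l //; lra.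
have [h [Gh xh _]] := maxfiltP (z + e *: q) x; set p := h *m x in xh.
(* At z the point p does no better than q, at z + e q no worse; the difference gives |q|^2 <= <q,
   p>, while |p| <= |q|. *)
have zp : ip z p <= ip z q by rewrite -yg -Ez; exact: maxfilt_ge.
have := maxfilt_ge (z + e *: q) y Gg; rewrite -/q -he xh !ipDl !ipZl => h1.
have h2 : ip q q <= ip q p by rewrite -(ler_pM2l e0); lra.
have E : q = p by apply: ip_eq_of_ge => //; rewrite !ip_orthogonal //; exact: Gorth.
by apply: (orbit_eq Gh Gg).
Qed.

(** Testing the maximizer for z at w shows that the function is Lipschitz. *)
Lemma scont_maxfilt x : scont setT (fun z => maxfilt G z x).
Proof.
move=> a _; apply/cvgrPdist_lt => e e0.
pose N := 1 + ip x x; have N0 : 0 < N by rewrite ltr_pwDl ?ip_ge0.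
have xN g i : G g -> `|(g *m x) i 0| <= N.
  move=> Gg; have := sqr_coord_le_ip (g *m x) i; rewrite ip_orthogonal; last exact: Gorth.
  rewrite -real_normK ?num_real // /N.
  by move: `|_| (normr_ge0 ((g *m x) i 0)) => b b0 hb; nra.
have le z w : maxfilt G z x - maxfilt G w x <= N * \sum_i `|z i 0 - w i 0|.
  have [g [Gg zg _]] := maxfiltP z x; have := maxfilt_ge w x Gg; rewrite zg => h1.
  apply: (@le_trans _ _ (ip (z - w) (g *m x))).
    by rewrite ipBl; lra.
  rewrite /ip mulr_sumr; apply: ler_sum => i _; apply: (le_trans (ler_norm _)).
  by rewrite normrM mulrC !mxE; apply: ler_wpM2r => //; have := xN g i Gg; rewrite mxE.
have c : N * \sum_i `|a i 0 - w i 0| @[w --> mnear setT a] --> N * \sum_i `|a i 0 - a i 0|.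
  apply: cvgM; first exact: cvg_cst.
  apply: cvg_sumr => i; apply: cvg_norm; apply: cvgB; [exact: cvg_cst | exact: mnear_coord].
have E : \sum_i `|a i 0 - a i 0| = 0 by apply: big1 => i _; rewrite subrr normr0.
rewrite E mulr0 in c.
have H := cvgr_lt _ c _ e0; near=> w.
have hw : N * \sum_i `|a i 0 - w i 0| < e by near: w; exact: H.
rewrite ltr_norml.
have := le a w; have := le w a.
have -> : \sum_i `|w i 0 - a i 0| = \sum_i `|a i 0 - w i 0|.
  by apply: eq_bigr => i _; rewrite distrC.
move: hw; move: (N * _) => r; lra.
Unshelve. all: by end_near. Qed.

End Group.

(** * Upper bounds on dimension *)

Section Dimension.
Variable R : realType.

Lemma polyf_fstc X m k (c : X -> 'cV[R]_k) F :
  polyf c F -> polyf (@extc R X m k c) (fun u => F u.1).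
Proof.
apply: polyf_comp => i; exists (PVar R (rshift m i) ord0) => u /=.
by rewrite /extc col_mxEd.
Qed.

Lemma polyf_sndc X m k (c : X -> 'cV[R]_k) j : polyf (@extc R X m k c) (fun u => u.2 j 0).
Proof. by exists (PVar R (lshift k j) ord0) => u /=; rewrite /extc col_mxEu. Qed.

(** The cells contained in S form the decomposition; one of full dimension would give S an interior
    point. *)
Lemma dim_le_empty_interior n (S : set 'cV[R]_n) : semialg S ->
  (forall x, ~ mnear setT x S) -> dim_le S (n%:Z - 1).
Proof.
move=> hS S0; have [I [C [K [cd ad]]]] := cell_decompositionP (fun _ : unit => hS).
pose I' := {i : I | `[< C i `<=` S >]}.
exists #|{: I'}|, (fun i => C (val (enum_val i))), (fun i => K (val (enum_val i))); split.
- by move=> i; exact: cell_semialg cd _.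
- by move=> i; exact: cell_homeo cd _.
- move=> i; have := cell_dim cd (val (enum_val i)).
  rewrite leq_eqVlt => /orP[/eqP /(cell_interior cd) [x ix]|lt]; last by rewrite lerBrDr -PoszD lez_nat addn1.
  case: (S0 x); apply: filterS ix; exact: (asboolP _ (valP (enum_val i))).
- move=> i j ij; apply/seteqP; split=> // x [Ci Cj].
  by move: ij; rewrite (enum_val_inj (val_inj (cell_inj cd Ci Cj))) eqxx.
- apply/seteqP; split=> x.
    move=> Sx; have [i Ci] := cell_cover cd x.
    have iS : `[< C i `<=` S >] by apply/asboolP => y Cy; exact: (ad i tt x y).
    by exists (enum_rank (Sub i iS : I')); rewrite enum_rankK SubK.
  by case=> i; exact: (asboolP _ (valP (enum_val i))).
Qed.

Lemma dim_le_singleton n (a : 'cV[R]_n) : dim_le [set a] 0.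
Proof.
exists 1%N, (fun=> [set a]), (fun=> 0%N); split=> //.
- move=> _; apply: semialgP; apply: (@eq_sdef _ _ _ _ (fun x => mdist2 x a = 0)).
    move=> x; split=> [h|->]; last exact: mdist2xx.
    apply/colP => i; apply/eqP; rewrite -subr_eq0 -sqrf_eq0 eq_le sqr_ge0 andbT -h.
    exact: sqr_le_mdist2.
  apply: sdef_eq; last exact: polyf_cst.
  apply: polyf_sum => i; apply: polyf_sum => j; rewrite (ord1 j).
  by apply: polyfM; apply: polyfB; by [exact: (polyf_coord id) | exact: polyf_cst].
- move=> _; exists (fun=> 0), (fun=> a); split=> //.
  + by move=> b _ [].
  + by move=> y _; apply/rowP => -[].
  + by split=> b _ e e0; exists 1 => // c _ _; rewrite mdist2xx.
- by move=> i j; rewrite !ord1 eqxx.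
- by apply/seteqP; split=> x; [move=> ->; exists ord0 | case].
Qed.

(** Transfers [scont] to the topology of the line, where [IVT] applies. *)
Lemma continuous_line n (h : 'cV[R]_n -> R) a b : scont setT h ->
  continuous (fun t : R => h (a + t *: b)).
Proof.
move=> ch t; apply/cvgrPdist_lt => e e0.
have [d d0 hd'] := cvgr_dist_lt _ _ (ch (a + t *: b) Logic.I) _ e0.
have c : mdist2 (a + t *: b) (a + u *: b) @[u --> t] --> (0 : R).
  apply: cvg_mdist2 => i j.
  rewrite !mxE; under eq_fun do rewrite !mxE.
  by apply: cvgD; [exact: cvg_cst | apply: cvgM; [exact: cvg_id | exact: cvg_cst]].
near=> u; apply: hd' => //; near: u; exact: (cvgr_lt _ c _ d0).
Unshelve. all: by end_near. Qed.

End Dimension.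

(** * The two positive separation statements *)

Section MaxFiltering.
Variables (R : realType) (d : nat) (G : set 'M[R]_d).
Hypothesis GO : subgroup_Od G.
Hypothesis Gsa : semialg G.

(** The maxima are compared through their upper bounds: they agree when every s bounds both or
    neither. Group elements are quantified as vectors with d d entries. *)
Lemma semialg_maxfilt_eq x y : semialg [set z | maxfilt G z x = maxfilt G z y].
Proof.
pose ub w (u : 'cV[R]_d * R) := ~ exists g : 'cV[R]_(d * d),
  G (vec_mx g^T) /\ u.2 < ip u.1 (vec_mx g^T *m w).
have ubE w z s : ub w (z, s) <-> maxfilt G z w <= s.
  have [g [Gg zg max]] := maxfiltP GO Gsa z w; rewrite /ub /=; split.
    move=> h; rewrite leNgt; apply/negP => lt; apply: h; exists (mxvec g)^T.
    by rewrite trmxK mxvecK -zg.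
  by move=> le [h [Gh lt]]; have := le_trans (max _ Gh) le; rewrite leNgt lt.
have sub w : sdef (ext id) (ub w).
  apply: sdef_not.
  apply: (sdef_exc (P := fun u => G (vec_mx u.2^T) /\ u.1.2 < ip u.1.1 (vec_mx u.2^T *m w))).
  have hg i j : polyf (extc (ext id)) (fun u : 'cV[R]_d * R * 'cV[R]_(d * d) => (vec_mx u.2^T : 'M_d) i j).
    rewrite [X in polyf _ X](_ : _ = fun u : 'cV[R]_d * R * 'cV[R]_(d * d) => u.2 (mxvec_index i j) 0); first exact: polyf_sndc.
    by apply/funext => u; rewrite !mxE.
  apply: sdef_and; first by apply: (sdef_semialg Gsa).
  apply: sdef_lt; first exact: (polyf_fstc _ (polyf_snd _)).
  apply: polyf_sum => i; apply: polyfM.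
    exact: (polyf_fstc _ (polyf_fst (polyf_coord id i))).
  rewrite [X in polyf _ X](_ : _ = fun u : 'cV[R]_d * R * 'cV[R]_(d * d) =>
      \sum_j (vec_mx u.2^T : 'M_d) i j * w j 0).
    by apply: polyf_sum => j; apply: polyfM; [exact: hg | exact: polyf_cst].
  by apply/funext => u; rewrite mxE.
apply: semialgP; have := sdef_all (sdef_iff (sub x) (sub y)).
apply: eq_sdef => z /=; split=> [h|E s].
  by apply/eqP; rewrite eq_le; apply/andP; split; apply/ubE; apply/h; apply/ubE.
by rewrite !ubE E.
Qed.

Lemma strongly_separating1 : strongly_separating G 1.
Proof.
move=> x y xy; apply: dim_le_empty_interior; first exact: semialg_maxfilt_eq.
by move=> z /(maxfilt_eq_interior GO Gsa).
Qed.

(** If the spheres are the orbits, the maximum for z and w is |z| |w|: Cauchy-Schwarz bounds it, and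
    the multiple of z of norm |w| attains the bound. As |x| and |y| differ, equality forces z =
    0. *)
Lemma strongly_separating_spheres : orbits_are_spheres G -> strongly_separating G d.
Proof.
move=> sph x y xy; rewrite subrr.
have nxy : ip x x <> ip y y by move=> E; apply: xy; rewrite !sph E.
suff -> : [set z | maxfilt G z x = maxfilt G z y] = [set 0] by exact: dim_le_singleton.
have ip0 (w : 'cV[R]_d) : ip 0 w = 0 by rewrite -(scale0r 0) ipZl mul0r.
apply/seteqP; split=> z /=; last first.
  by move=> ->; have [g [_ -> _]] := maxfiltP GO Gsa 0 x; have [h [_ -> _]] := maxfiltP GO Gsa 0 y;
    rewrite !ip0.
move=> E; apply: contrapT => z0; apply: nxy.
have c0 : 0 < ip z z.
  by rewrite lt_neqAle ip_ge0 andbT eq_sym; apply/eqP => /ip_eq0.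
have mE w : maxfilt G z w = Num.sqrt (ip w w * ip z z).
  have [g [Gg zg max]] := maxfiltP GO Gsa z w.
  apply/eqP; rewrite eq_le; apply/andP; split.
    rewrite zg; apply: (le_trans (ler_norm _)); rewrite -sqrtr_sqr ler_sqrt; last first.
      by rewrite mulr_ge0 ?ip_ge0.
    have := cauchy_schwarz z (g *m w); rewrite ip_orthogonal; last by case: GO => h _ _ _; exact: h.
    by rewrite mulrC.
  pose a := Num.sqrt (ip w w / ip z z).
  have a2 : a ^+ 2 * ip z z = ip w w by rewrite sqr_sqrtr ?divr_ge0 ?ip_ge0 // divfK ?gt_eqF.
  have : Defs.orbit G w (a *: z) by rewrite sph /= ipZl ipZr mulrA -expr2.
  case=> h Gh hE; have := max h Gh; rewrite hE ipZr; apply: le_trans.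
  rewrite -a2 -mulrA -expr2 -exprMn sqrtr_sqr ger0_norm //.
  by rewrite mulr_ge0 ?sqrtr_ge0 ?ip_ge0.
move: E; rewrite !mE => /eqP; rewrite eqr_sqrt ?mulr_ge0 ?ip_ge0 // => /eqP.
by apply: mulIf; rewrite gt_eqF.
Qed.

End MaxFiltering.

(** * Failure of 2-strong separation *)

Section Codimension.
Variables (R : realType) (n : nat) (G : set 'M[R]_(1 + n)).
Hypothesis GO : subgroup_Od G.
Hypothesis Gsa : semialg G.
Local Notation cns t u := (col_mx (t%:M : 'M[R]_1) u : 'cV[R]_(1 + n)).

(** Equality case of Cauchy-Schwarz: if <x, g y> reached |x|^2, then g y would be x. *)
Lemma maxfilt_self_lt (x y : 'cV[R]_(1 + n)) : ip x x = ip y y ->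
  Defs.orbit G x <> Defs.orbit G y -> maxfilt G x y < maxfilt G x x.
Proof.
case: (GO) => Gorth G1 _ _ E xy; have [g [Gg -> _]] := maxfiltP GO Gsa x y.
apply: (@lt_le_trans _ _ (ip x x)); last first.
  by have := maxfilt_ge GO Gsa x x G1; rewrite mul1mx.
rewrite ltNge; apply/negP => h; apply: xy; apply: (orbit_eq GO G1 Gg); rewrite mul1mx.
by apply: ip_eq_of_ge => //; rewrite ip_orthogonal ?E //; exact: Gorth.
Qed.

Lemma maxfilt_eq_dim (x y : 'cV[R]_(1 + n)) : ip x x = ip y y ->
  Defs.orbit G x <> Defs.orbit G y ->
  ~ dim_le [set z | maxfilt G z x = maxfilt G z y] ((1 + n)%N%:Z - 2).
Proof.
move=> nE xy [c [C [K [Csa Chom Kdim _ ZE]]]].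
have [i0 di0] : exists i, (y - x) i 0 != 0.
  apply: contrapT => h; apply: xy; congr Defs.orbit; apply/esym/colP => i.
  apply/eqP; rewrite -subr_eq0; apply: contrapT => hi; apply: h; exists i.
  by rewrite !mxE; apply/negP.
(* Affine coordinates of R^(1+n) with first axis the line through x and y *)
pose ins (u : 'cV[R]_n) : 'cV[R]_(1 + n) :=
  \col_i (if unlift i0 i is Some k then u k 0 else 0).
pose chart (w : 'cV[R]_(1 + n)) := (x + ins (tl w)) + hd w *: (y - x).
have chart_cns t u : chart (cns t u) = (x + ins u) + t *: (y - x).
  by rewrite /chart tl_cns hd_cns.
have lineE (a b : 'cV[R]_(1 + n)) r i : (a + r *: b) i 0 = a i 0 + r * b i 0.
  by rewrite [LHS]mxE [X in _ + X]mxE.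
have ins_i0 u : ins u i0 0 = 0 by rewrite mxE unlift_none.
have chart_inj t t' u u' : chart (cns t u) = chart (cns t' u') -> u = u'.
  rewrite !chart_cns => E.
  have Et : t = t'.
    have := congr1 (fun w : 'cV_(1 + n) => w i0 0) E.
    rewrite /= !lineE [(x + ins u) _ _]mxE [(x + ins u') _ _]mxE !ins_i0.
    by move=> /addrI /mulIf; apply.
  rewrite Et in E; move/addIr/addrI: E => E; apply/colP => k.
  by have := congr1 (fun w : 'cV_(1 + n) => w (lift i0 k) 0) E; rewrite /= !mxE liftK.
have chart_poly i j : polyf id (fun w : 'cV[R]_(1 + n) => chart w i j).
  rewrite [X in polyf _ X](_ : _ = fun w : 'cV_(1 + n) =>
    (x i 0 + (if unlift i0 i is Some k then w (rshift 1 k) 0 else 0)) +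
    w (lshift n ord0) 0 * (y - x) i 0); last first.
    apply/funext => w; rewrite (ord1 j) /chart lineE [(x + ins _) _ _]mxE.
    by congr (_ + _ + _); rewrite mxE; case: unlift => // k; rewrite mxE.
  apply: polyfD; last by apply: polyfM; [exact: (polyf_coord id) | exact: polyf_cst].
  apply: polyfD; first exact: polyf_cst.
  by case: unlift => [k|]; [exact: (polyf_coord id) | exact: polyf_cst].
have chart_cont i j : scont setT (fun w : 'cV[R]_(1 + n) => chart w i j).
  by have [p hp] := chart_poly i j; apply: (eq_scont _ (@scont_peval _ _ _ setT p)) => w _; rewrite hp.
have Ssa i : semialg [set w | C i (chart w)].
  by apply: semialgP; apply: (sdef_semialg (Csa i)).
have [I [D [L [cd sec]]]] := cylinder_section (@cell_decompositionP R n) Ssa.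
pose H z := maxfilt G z x - maxfilt G z y.
have cH : scont setT H by apply: scontB; exact: scont_maxfilt.
have cHt t : scont setT (fun u : 'cV[R]_n => H (chart (cns t u))).
  apply: (@scont_comp _ _ _ _ _ _ setT (fun u => chart (cns t u)) H) => // i j.
  apply: (@scont_comp _ _ _ _ _ _ setT (fun u => cns t u) (fun w => chart w i j)) => //.
  by apply: scont_cns_comp => *; [exact: scont_cst | exact: scont_coord].
have ins0 : ins 0 = 0.
  by apply/colP => i; rewrite !mxE; case: unlift => // k; rewrite mxE.
have H0 : 0 < H (chart (cns 0 0)).
  by rewrite chart_cns ins0 addr0 scale0r addr0 /H subr_gt0; exact: maxfilt_self_lt.
have H1 : H (chart (cns 1 0)) < 0.
  rewrite chart_cns ins0 addr0 scale1r addrC subrK /H subr_lt0; apply: maxfilt_self_lt => //.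
  by move=> E; apply: xy.
(* The signs of H at both ends persist for base points near 0. A base cell of full dimension
   contains such a point u with a neighbourhood, and H vanishes on the line over u. *)
have [e0 e00 he0] := cvgr_gt _ (cHt 0 0 Logic.I) _ H0.
have [e1 e10 he1] := cvgr_lt _ (cHt 1 0 Logic.I) _ H1.
have e01 : 0 < Num.min e0 e1 by rewrite lt_min e00.
have [i [u [Lu]]] := cell_dense cd 0 e01; rewrite lt_min => /andP[d0 d1] iDu.
have Du : D i u := mnear_self (S := setT) Logic.I iDu.
have [t _ Ht] : exists2 t, t \in `[0, 1] & H (chart (cns t u)) = 0.
  have E : (fun t : R => H (chart (cns t u))) = (fun t => H ((x + ins u) + t *: (y - x))).
    by apply/funext => t; rewrite chart_cns.
  apply: (IVT (f := fun t => H (chart (cns t u)))) => //.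
    by rewrite E; apply: continuous_subspaceT; exact: continuous_line.
  have h0 := he0 u Logic.I d0; have h1 := he1 u Logic.I d1.
  by rewrite ge_min le_max (ltW h0) (ltW h1) orbT.
have [j Cj] : exists j, C j (chart (cns t u)).
  have : [set z | maxfilt G z x = maxfilt G z y] (chart (cns t u)).
    by move/eqP: Ht; rewrite subr_eq0 => /eqP.
  by rewrite ZE.
have [s cs hs] := sec i j u t Du Cj.
have [f [g [fD gD gf fg [_ /cont_onP cg]]]] := cell_homeo cd i; rewrite Lu in f g fD gD gf fg cg.
have [f' [g' [fC gC gf' fg' [/cont_onP cf' _]]]] := Chom j.
have CE v : cube v -> C j (chart (cns (s (g v)) (g v))) by move=> cv; apply: (hs _ (gD _ cv)).
(* Over the base cell the section stays in [C j], and it is injective because the chart determines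
   the base point. Followed by the homeomorphism of [C j], it embeds the n-cube in a cube of
   dimension [K j], which is at most n - 1. *)
have : (n <= K j)%N.
  apply: (@cube_embedding_dim R n (K j) (fun v => f' (chart (cns (s (g v)) (g v))))).
  - apply/cont_onP => a b; apply: (scont_comp CE _ (cf' a b)) => k l.
    apply: (@scont_comp _ _ _ _ _ _ setT (fun v => cns (s (g v)) (g v)) (fun w => chart w k l)) => //.
    by apply: scont_cns_comp => //; exact: (scont_comp gD).
  - by move=> v cv; apply: fC; exact: CE.
  - move=> v w cv cw E; have : chart (cns (s (g v)) (g v)) = chart (cns (s (g w)) (g w)).
      by rewrite -(gf' _ (CE v cv)) E gf' //; exact: CE.
    by move/chart_inj => gE; rewrite -(fg v cv) gE fg.
have := Kdim j; lia.
Qed.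

End Codimension.

Theorem theorem11 (R : realType) (d : nat) (G : set 'M[R]_d) :
  subgroup_Od G -> semialg G ->
  (orbits_are_spheres G -> strongly_separating G d) /\
  (~ orbits_are_spheres G -> strongly_separating G 1 /\ ~ strongly_separating G 2).
Proof.
move=> GO Gsa; split=> [sph|nsph]; first exact: strongly_separating_spheres.
split; first exact: strongly_separating1.
move=> sep; apply: nsph => x; apply/seteqP; split=> y /=.
  by case=> g Gg <-; rewrite ip_orthogonal //; case: GO => h _ _ _; exact: h.
(* Orbits lie in spheres; a sphere that is not an orbit contains two points of equal norm in
   distinct orbits. *)
move=> nE; apply: contrapT => yx.
have xy : Defs.orbit G x <> Defs.orbit G y.
  move=> E; apply: yx; rewrite E; exists 1%:M; first by case: GO.
  by rewrite mul1mx.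
(* In dimension 0 there is only one point; otherwise d = 1 + n, with one coordinate for the
   direction y - x. *)
case: d G GO Gsa sep x y nE yx xy => [|n] G GO Gsa sep x y nE yx xy.
  by apply: xy; congr Defs.orbit; apply/colP => -[].
exact: (maxfilt_eq_dim GO Gsa (esym nE) xy (sep _ _ xy)).
Qed.
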